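(* Let $K$ be a cell complex. Then $K$ zips onto a point (a one-element poset) if and only if the dual poset $K^*$ is constructible.
   Context: All posets are finite. For a finite poset $P$, $|P|$ is the polyhedron given by the geometric realization of the simplicial complex of nonempty chains of $P$. A cell complex is a finite poset $P$ such that for every $p\in P$ the polyhedron $|\{q\in P: q<p\}|$ is PL homeomorphic to a PL sphere of some dimension $\ge -1$ (the $(-1)$-sphere being empty). The dual poset $K^*$ is the same set with the opposite order. We say $p$ covers $q$ (or $q$ is covered by $p$) if $q<p$ and there is no $r$ with $q<r<p$. Quotient poset: if $J$ is a subposet of a poset $P$, $P/J$ is the set obtained from $P$ by identifying all elements of $J$ to one element, with $x\le y$ in $P/J$ iff there exist representatives $p\in x$ and $p'\in y$ with $p\le p'$ in $P$. Zipping: suppose that $p\in P$ covers two incomparable elements $q,r\in P$ such that (1) if $s<p$ and $s\ne q,r$, then $s<q$ and $s<r$; and (2) if $s>q$ and $s>r$, then $s\ge p$. Then $P$ is said to elementarily zip onto the quotient poset $P/\{p,q,r\}$. A zipping is a (finite, possibly empty) sequence of elementary zippings; $P$ zips onto $Q$ if there is a zipping from $P$ to (a poset isomorphic to) $Q$. Constructible poset (inductive definition): a subposet $Q\subset P$ is an order ideal if $p\le q\in Q$ implies $p\in Q$. A poset $P$ is constructible if either $P$ has a greatest element, or $P=Q\cup R$ where $Q$ and $R$ are order ideals of $P$ such that each of $Q$, $R$ and $Q\cap R$ is constructible, and every maximal element of $Q\cap R$ is covered by a maximal element of $Q$ and by a maximal element of $R$. The empty poset is not constructible. *)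

(* Defs.v *)
From mathcomp Require Import all_boot all_order all_algebra.
From mathcomp Require Import classical_sets reals.

Set Implicit Arguments.
Unset Strict Implicit.
Unset Printing Implicit Defensive.

Import Order.TTheory GRing.Theory Num.Theory.

Local Open Scope ring_scope.
Local Open Scope order_scope.

Section Polyhedra.
Variable R : realType.

(* The polytope spanned by the points in [s]; it is empty when [s] is. *)
Definition conv_hull (E : lmodType R) (s : seq E) : set E :=
  fun x => exists a : 'I_(size s) -> R,
    [/\ forall i, 0 <= a i, \sum_i a i = 1 & x = \sum_i a i *: tnth (in_tuple s) i]%R.

Definition affine_on (E F : lmodType R) (C : set E) (f : E -> F) : Prop :=
  forall (x y : E) (t : R), C x -> C y -> (0 <= t <= 1)%R ->
    f (t *: x + (1 - t) *: y)%R = (t *: f x + (1 - t) *: f y)%R.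

(* Piecewise linear maps between compact polyhedra: [X] is a finite union of
   polytopes, on each of which [f] is affine.  Continuity on [X] is automatic,
   since polytopes are closed and there are finitely many of them. *)
Definition pl_map (E F : lmodType R) (X : set E) (Y : set F) (f : E -> F) :
    Prop :=
  (forall x, X x -> Y (f x)) /\
  exists cs : seq (seq E),
    (forall x, X x <-> exists2 s, s \in cs & conv_hull s x) /\
    (forall s, s \in cs -> affine_on (conv_hull s) f).

Definition pl_homeomorphic (E F : lmodType R) (X : set E) (Y : set F) : Prop :=
  exists (f : E -> F) (g : F -> E),
    [/\ pl_map X Y f, pl_map Y X g,
        forall x, X x -> g (f x) = x & forall y, Y y -> f (g y) = y].

(* [R^o] is [R] as a module over itself, which makes this an [lmodType R]. *)
Definition coord_space (V : finType) : lmodType R := {ffun V -> R^o}.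

(* [D] is the set of nonempty simplices of a complex with vertices in [V];
   the vertex [v] is realized as the [v]-th unit vector, so that the points are
   given by their barycentric coordinates. *)
Definition realization (V : finType) (D : {set {set V}}) :
    set (coord_space V) :=
  fun x => [/\ forall v, (0 <= x v)%R, (\sum_v x v = 1)%R
             & [set v | x v != 0%R] \in D].

(* The boundary of the [n]-simplex, i.e. the PL sphere of dimension [n - 1];
   it is empty for [n = 0]. *)
Definition simplex_boundary (n : nat) : {set {set 'I_n.+1}} :=
  [set s | (s != finset.set0) && (s != finset.setT)].

Definition is_pl_sphere (E : lmodType R) (X : set E) : Prop :=
  exists n : nat, pl_homeomorphic X (realization (simplex_boundary n)).

End Polyhedra.
Arguments realization R {V} D _.

Section Posets.
Variables (d : Order.disp_t) (P : finPOrderType d).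
Implicit Types (A I Q S : {set P}) (p q r : P).

(* Subposets of [P] are subsets with the induced order. *)

Definition order_complex A : {set {set P}} :=
  [set s : {set P} | [&& s != finset.set0, s \subset A
    & [forall x in s, forall y in s, x >=< y]]].

Definition cell_complex (R : realType) : Prop :=
  forall p, is_pl_sphere (realization R (order_complex [set q | q < p])).

Definition covers_in A p q : Prop :=
  [/\ p \in A, q \in A, q < p & forall r, r \in A -> ~ (q < r /\ r < p)].

Definition covers p q : Prop := covers_in [set: P] p q.

Definition maximal_in A p : Prop :=
  p \in A /\ forall q, q \in A -> ~ p < q.

Definition order_ideal A I : Prop :=
  I \subset A /\ forall p q, p \in A -> q \in I -> p <= q -> p \in I.

Inductive constructible : {set P} -> Prop :=
| constructible_top A p :
    p \in A -> (forall q, q \in A -> q <= p) -> constructible A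
| constructible_union A Q S :
    A = Q :|: S -> order_ideal A Q -> order_ideal A S ->
    constructible Q -> constructible S -> constructible (Q :&: S) ->
    (forall x, maximal_in (Q :&: S) x ->
       (exists2 y, maximal_in Q y & covers_in A y x) /\
       (exists2 z, maximal_in S z & covers_in A z x)) ->
    constructible A.

(* The elements of the quotient set [P / A] are the equivalence classes. *)
Definition quotient_class A p : {set P} := if p \in A then A else [set p].

Definition quotient A : Type :=
  {C : {set P} | C \in [set quotient_class A p | p in [set: P]]}.

Definition quotient_le A (C D : quotient A) : bool :=
  [exists p in val C, exists q in val D, p <= q].

Definition zippable p q r : Prop :=
  [/\ covers p q, covers p r, q >< r,
      forall s, s < p -> s != q -> s != r -> s < q /\ s < r
    & forall s, q < s -> r < s -> p <= s].

End Posets.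

Definition poset_isomorphic (d d' : Order.disp_t) (P : finPOrderType d)
    (Q : finPOrderType d') : Prop :=
  exists2 f : P -> Q, bijective f & {mono f : x y / x <= y}.

(* [Q] is isomorphic to [P / {p, q, r}]. *)
Definition elementarily_zips (d d' : Order.disp_t) (P : finPOrderType d)
    (Q : finPOrderType d') : Prop :=
  exists p q r : P, zippable p q r /\
  exists2 f : Q -> quotient [set p; q; r], bijective f
    & forall x y, (x <= y) = quotient_le (f x) (f y).

Inductive zips_onto : forall (d d' : Order.disp_t),
    finPOrderType d -> finPOrderType d' -> Prop :=
| zips_onto_iso d d' (P : finPOrderType d) (Q : finPOrderType d') :
    poset_isomorphic P Q -> zips_onto P Q
| zips_onto_step d d1 d' (P : finPOrderType d) (P1 : finPOrderType d1)
    (Q : finPOrderType d') :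
    elementarily_zips P P1 -> zips_onto P1 Q -> zips_onto P Q.

(* Main.v *)
Require Import Defs.
From mathcomp Require Import all_boot all_order all_algebra.
From mathcomp Require Import classical_sets reals.
From HB Require Import structures.
From mathcomp Require Import boolp lra ring.

(** Write [cov z y] when [y] covers [z], where [z = None] stands for a bottom element
    added below the poset.  The proof replaces the topological hypothesis by a
    combinatorial one, [cellular], which says of the covering relation that
    - intervals of length two contain only elements of the middle rank,
    - the mod 2 boundary (the sum of the covered elements) squares to zero,
    - a set of facets of one cell that is a mod 2 cycle is empty or is the set of
      all its facets.

    A cell complex is cellular ([cell_complex_cellular]).  For this it is enough to
    know of every interval, the added bottom included, that it is not a single
    element and that it is either connected or consists of two incomparable elements
    ([interval_spheric]).  The boundary of a cell is a PL sphere, so the cone over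
    its order complex is in piecewise linear, positively homogeneous bijection with
    a vector space.  The graph of this bijection is a finite union of finitely
    generated cones.  Its derivative at the direction of a vertex [v] is a bijection
    of the same kind between [R x cone(link of v)] and the same vector space, and it
    commutes with translations along [v].  Derivatives along the vertices of a maximal
    chain of elements up to [q] lead to the interval above [q].  If the interval falls
    apart into two pieces, a path in the vector space from one piece to the other has
    to cross the image of the span of the chain, which therefore has codimension 1:
    two half-lines remain, hence two elements.

    Let [pi] identify [p], [q], [r] in an elementary zipping.  Modulo 2 it induces a
    chain map that kills [p] ([cov_pi_sum]), from which the quotient is cellular
    again ([zip_cellular]).

    On the poset itself, constructibility of the dual is a condition on upward closed
    sets, [coconstructible].  If a poset zips to a point, pulling the decompositions
    back along each [pi] shows that it is coconstructible
    ([coconstructible_preimage]); the cone over the identified cell becomes the union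
    of the cones over [q] and [r], whose intersection is the cone over [p].

    Conversely, a coconstructible cellular poset with a least element is a point
    ([bottom_singleton]).  Otherwise, follow a decomposition down: as long as
    a part is not a cone go to that part, and once both parts are cones, over [q] and
    [r], go to their intersection.  This ends at two cones over [q] and [r] whose
    intersection is a cone over some [p].  The pairs [q], [r] met on the way form
    octahedral spheres of increasing dimension, so by the cycle condition the facets
    of [p] are exactly [q] and [r], and both have the same facets.  This makes
    the triple zippable, and every set of the decomposition either contains the triple
    or avoids it, so the decomposition passes to the quotient
    ([coconstructible_zips]).  The theorem follows by induction on the number of
    elements. *)

Set Implicit Arguments.
Unset Strict Implicit.
Unset Printing Implicit Defensive.

Import Order.TTheory GRing.Theory Num.Theory.

Local Open Scope ring_scope.

(** * Polyhedral cones along a ray *)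

Section Germs.
Variable R : realFieldType.

(** Together with [eventually]: arbitrarily small, respectively all small enough,
    positive parameters. *)
Definition frequently (Q : R -> Prop) : Prop :=
  forall e, 0 < e -> exists2 t, 0 < t <= e & Q t.

Definition eventually (Q : R -> Prop) : Prop :=
  exists2 e, 0 < e & forall t, 0 < t <= e -> Q t.

Lemma eventually_frequently Q : eventually Q -> frequently Q.
Proof.
move=> [e e0 He] e' e'0; exists (Num.min e e'); last apply: He.
  by rewrite lt_min e0 e'0 ge_min lexx orbT.
by rewrite lt_min e0 e'0 ge_min lexx.
Qed.

Lemma eventuallyW (Q Q' : R -> Prop) :
  (forall t, 0 < t -> Q t -> Q' t) -> eventually Q -> eventually Q'.
Proof.
by move=> h [e e0 He]; exists e => // t /[dup] /andP[t0 _] /He; apply: h.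
Qed.

Lemma eventually_and Q Q' :
  eventually Q -> eventually Q' -> eventually (fun t => Q t /\ Q' t).
Proof.
move=> [e e0 He] [e' e'0 He']; exists (Num.min e e'); first by rewrite lt_min e0.
move=> t /andP[t0]; rewrite le_min => /andP[te te'].
by split; [apply: He | apply: He']; rewrite t0.
Qed.

Lemma eventually_true (Q : R -> Prop) : (forall t, 0 < t -> Q t) -> eventually Q.
Proof. by move=> h; exists 1 => // t /andP[t0 _]; apply: h. Qed.

Lemma eventually_ex (Q : R -> Prop) : eventually Q -> exists2 t, 0 < t & Q t.
Proof. by move=> [e e0 h]; exists e => //; apply: h; rewrite e0 lexx. Qed.

Lemma eventually_forall (I : finType) (Q : I -> R -> Prop) :
  (forall i, eventually (Q i)) -> eventually (fun t => forall i, Q i t).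
Proof.
move=> h.
have H (s : seq I) : eventually (fun t => forall i, i \in s -> Q i t).
  elim: s => [|i s IH]; first exact: eventually_true.
  apply: eventuallyW (eventually_and (h i) IH) => t _ [hi hs] j.
  by rewrite inE => /orP[/eqP->|/hs].
by apply: eventuallyW (H (enum I)) => t _ H' i; apply: H'; rewrite mem_enum.
Qed.

(** Only finitely many cases can occur, and if each were absent below some bound, so
    would be all of them below the least bound. *)
Lemma frequently_pigeonhole (I : eqType) (s : seq I) (Q : I -> R -> Prop) :
  frequently (fun t => exists2 i, i \in s & Q i t) ->
  exists2 i, i \in s & frequently (Q i).
Proof.
elim: s => [|i s IH] h; first by have [t _ []] := h 1 ltr01.
have [hi|] := pselect (frequently (Q i)); first by exists i; rewrite ?mem_head.
move=> /existsNP[e /not_implyP[e0 /forall2NP he]].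
have [|j js hj] := IH; last by exists j; rewrite // inE js orbT.
move=> e' e'0; have m0 : 0 < Num.min e e' by rewrite lt_min e0.
have [t /andP[t0]] := h _ m0.
rewrite le_min => /andP[te te'] [j].
rewrite inE => /orP[/eqP->|js] Qj; last by exists t; [rewrite t0|exists j].
by case: (he t) => //; rewrite t0.
Qed.

Lemma eventually_pos (a b : R) : 0 < a -> eventually (fun t => 0 < a + t * b).
Proof.
have b0 : 0 < `|b| + 1 by rewrite ltr_wpDl.
move=> a0; exists (a / (`|b| + 1)); first by rewrite divr_gt0.
move=> t /andP[t0]; rewrite ler_pdivlMr // => h.
have : - `|b| <= b by rewrite lerNl -normrN ler_norm.
nra.
Qed.

Lemma frequently_limit_ge0 (a b : R) :
  frequently (fun t => 0 <= a + t * b) -> 0 <= a.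
Proof.
move=> h; rewrite leNgt; apply/negP => a0.
have [|e e0 he] := @eventually_pos (- a) (- b); first by rewrite oppr_gt0.
by have [t /he ht ha] := h _ e0; lra.
Qed.

End Germs.

Section Cones.
Variables (R : realFieldType).
Implicit Types M E F : lmodType R.

(** The coefficients are indexed by [nat] so that lists of the same length can share
    them. *)
Definition cone M (s : seq M) (x : M) : Prop :=
  exists2 a : nat -> R, (forall i, 0 <= a i) & x = \sum_(i < size s) a i *: s`_i.

Lemma coneD M (s : seq M) x y : cone s x -> cone s y -> cone s (x + y).
Proof.
move=> [a a0 ->] [b b0 ->]; exists (fun i => a i + b i).
  by move=> i; rewrite addr_ge0.
by rewrite -big_split /=; apply: eq_bigr => i _; rewrite scalerDl.
Qed.

Lemma coneZ M (s : seq M) t x : 0 <= t -> cone s x -> cone s (t *: x).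
Proof.
move=> t0 [a a0 ->]; exists (fun i => t * a i).
  by move=> i; rewrite mulr_ge0.
by rewrite scaler_sumr; apply: eq_bigr => i _; rewrite scalerA.
Qed.

Lemma cone0 M (s : seq M) : cone s 0.
Proof.
by exists (fun=> 0) => //; rewrite big1 // => i _; rewrite scale0r.
Qed.

Lemma cone_cons M (s : seq M) m x :
  cone (m :: s) x <-> exists2 b, 0 <= b & cone s (x - b *: m).
Proof.
split=> [[a a0 ->]|[b b0 [a a0 h]]].
  exists (a 0%N) => //; exists (fun i => a i.+1) => //.
  by rewrite big_ord_recl /= addrC addrA addNr add0r.
exists (fun i => if i is j.+1 then a j else b); first by case.
by rewrite big_ord_recl /= -h addrC subrK.
Qed.

Lemma cone_image M E (h : {linear M -> E}) (s : seq M) x :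
  cone s x -> cone (map h s) (h x).
Proof.
move=> [a a0 ->]; exists a => //; rewrite size_map linear_sum.
by apply: eq_bigr => i _; rewrite linearZ /= (nth_map 0).
Qed.

Definition independent_on M n (v : 'I_n -> M) (J : {set 'I_n}) : Prop :=
  forall b : 'I_n -> R, \sum_(i in J) b i *: v i = 0 -> forall i, i \in J -> b i = 0.

(** Subtracting a suitable multiple of a linear relation removes a generator while
    the coefficients stay nonnegative; this stops at an independent set. *)
Lemma caratheodory M n (v : 'I_n -> M) (J : {set 'I_n}) (a : 'I_n -> R) :
  (forall i, 0 <= a i) ->
  exists (J' : {set 'I_n}) (a' : 'I_n -> R),
    [/\ independent_on v J', forall i, 0 <= a' i &
        \sum_(i in J) a i *: v i = \sum_(i in J') a' i *: v i].
Proof.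
have [k] := ubnP #|J|; elim: k J a => // k IH J a ltJ a0.
have [ind|] := pselect (independent_on v J); first by exists J, a.
move=> /existsNP[b0 /not_implyP[b00 /existsNP[i1 /not_implyP[i1J /eqP bi1]]]].
have [b bv0 [i2 i2J b2]] : exists2 b : 'I_n -> R,
    \sum_(i in J) b i *: v i = 0 & exists2 i, i \in J & 0 < b i.
  case: (ltrgt0P (b0 i1)) => h; first by exists b0 => //; exists i1.
    exists (fun i => - b0 i); last by exists i1; rewrite // oppr_gt0.
    under eq_bigr do rewrite scaleNr.
    by rewrite sumrN b00 oppr0.
  by rewrite h eqxx in bi1.
pose ok := [pred i | (i \in J) && (0 < b i)].
have ok2 : ok i2 by rewrite /= i2J.
have [i3 /andP[i3J b3] min3] := arg_minP (fun i => a i / b i) ok2.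
(* The largest multiple of the relation [b] that keeps the coefficients [a]
   nonnegative; subtracting it makes the coefficient of [i3] vanish. *)
pose r := a i3 / b i3.
have r0 : 0 <= r by rewrite divr_ge0 // ltW.
pose a' i := if i \in J then a i - r * b i else 0.
have a'0 i : 0 <= a' i.
  rewrite /a'; case: ifP => // iJ; rewrite subr_ge0.
  have [bi|bi] := ltP 0 (b i); first by rewrite -ler_pdivlMr ?min3 //= iJ.
  by apply: le_trans (a0 i); rewrite mulr_ge0_le0.
have [|J' [a'' [h1 h2 h3]]] := IH (J :\ i3) a' _ a'0.
  by move: ltJ; rewrite (cardsD1 i3 J) i3J.
exists J', a''; split=> //; rewrite -h3.
have -> : \sum_(i in J :\ i3) a' i *: v i = \sum_(i in J) a' i *: v i.
  have a'3 : a' i3 = 0 by rewrite /a' ifT // /r divfK ?gt_eqF // subrr.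
  rewrite [RHS](bigD1 i3) //= a'3 scale0r add0r.
  by apply: eq_bigl => i; rewrite in_setD1 andbC.
under [RHS]eq_bigr => i iJ do rewrite /a' iJ scalerBl -scalerA.
by rewrite sumrB -scaler_sumr bv0 scaler0 subr0.
Qed.

(** Polyhedral cones are closed, made precise on coefficients: if a ray starting at
    [x] meets the cone arbitrarily close to [x], then along the ray the point has
    coefficients that are affine in the parameter and nonnegative up to the limit.
    By Caratheodory and the pigeonhole principle the points can be taken in the cone
    over one independent set of generators, where coefficients are unique. *)
Lemma cone_ray_closed M (s : seq M) x w :
  frequently (fun t => cone s (x + t *: w)) ->
  exists (al be : nat -> R) (e : R),
    [/\ x = \sum_(i < size s) al i *: s`_i,
        w = \sum_(i < size s) be i *: s`_i, 0 < e &
        forall t i, 0 <= t <= e -> 0 <= al i + t * be i].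
Proof.
move=> hf; set n := size s; pose v (i : 'I_n) := s`_i.
have [J _ hJ] : exists2 J, J \in enum {set 'I_n} & frequently (fun t =>
    exists2 a : 'I_n -> R, forall i, 0 <= a i &
      independent_on v J /\ x + t *: w = \sum_(i in J) a i *: v i).
  apply: frequently_pigeonhole => e /hf[t te [a a0 eqa]]; exists t => //.
  have [|J [a' [ind a'0 eq']]] := @caratheodory _ n v [set: 'I_n]%SET a.
    by move=> i; apply: a0.
  exists J; first by rewrite mem_enum.
  exists a' => //; split=> //; rewrite -eq' eqa.
  by apply: eq_bigl => i; rewrite finset.in_setT.
have [t1 /andP[t10 _] [a1 a10 [ind eq1]]] := hJ 1 ltr01.
have [t2 /andP[t20 t21] [a2 a20 [_ eq2]]] := hJ (t1 / 2) (divr_gt0 t10 (ltr0Sn R 1)).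
(* The affine interpolation of the coefficients found at [t1] and [t2]; by
   independence it gives the coefficients at all other parameters with support
   in [J]. *)
have d0 : 0 < t1 - t2 by lra.
pose be i := (a1 i - a2 i) / (t1 - t2); pose al i := a1 i - t1 * be i.
have sb : w = \sum_(i in J) be i *: v i.
  have : (t1 - t2) *: w = (t1 - t2) *: \sum_(i in J) be i *: v i.
    rewrite scaler_sumr.
    under eq_bigr => i _ do rewrite scalerA /be mulrC divfK ?gt_eqF // scalerBl.
    by rewrite sumrB -eq1 -eq2 opprD addrACA subrr add0r scalerBl.
  by apply: scalerI; rewrite gt_eqF.
have sa : x = \sum_(i in J) al i *: v i.
  under eq_bigr => i _ do rewrite scalerBl -scalerA.
  by rewrite sumrB -scaler_sumr -sb -eq1 addrK.
have al0 i : i \in J -> 0 <= al i.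
  move=> iJ; apply: (@frequently_limit_ge0 _ _ (be i)) => e /hJ[t te [a a0 [_ eqa]]].
  exists t => //; suff -> : al i + t * be i = a i by [].
  apply/eqP; rewrite -subr_eq0; apply/eqP.
  apply: (ind (fun i => al i + t * be i - a i)) => //.
  under eq_bigr => j _ do rewrite scalerBl scalerDl -scalerA.
  by rewrite sumrB -eqa big_split /= -sa -scaler_sumr -sb subrr.
pose ext (c : 'I_n -> R) k := if insub k is Some i then
   if i \in J then c i else 0 else 0.
have extS c : \sum_(i in J) c i *: v i = \sum_(i < n) ext c i *: s`_i.
  rewrite big_mkcond; apply: eq_bigr => i _; rewrite /ext valK.
  by case: ifP; rewrite ?scale0r.
exists (ext al), (ext be), t1; rewrite -!extS; split=> // t i /andP[t0 tt].
rewrite /ext; case: insubP => [j _ _|_]; last by lra.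
case: ifP => jJ; last by lra.
have := al0 j jJ; have := a10 j; have -> : a1 j = al j + t1 * be j by rewrite subrK.
have [b0|b0] := leP 0 (be j); first by have := mulr_ge0 t0 b0; lra.
by have : t1 * be j <= t * be j; [rewrite ler_nM2r|lra].
Qed.

End Cones.

(** * Piecewise linear charts and their derivatives *)

Section Fans.
Variable R : realFieldType.
Implicit Types M E F : lmodType R.

(** A fan stands for a finite union of finitely generated cones, given by their
    generators; positively homogeneous piecewise linear maps are represented by fans
    that are their graphs. *)
Definition fan M (G : seq (seq M)) (m : M) : Prop :=
  exists2 c, c \in G & cone c m.

Lemma fanZ M (G : seq (seq M)) t m : 0 <= t -> fan G m -> fan G (t *: m).
Proof. by move=> t0 [c cG mc]; exists c => //; apply: coneZ. Qed.

(** A cone that contains [p] looks near [p] like the cone generated by it and [- p];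
    the other cones are invisible from [p] because cones are closed. *)
Definition derivative M (G : seq (seq M)) (p : M) : seq (seq M) :=
  [seq - p :: c | c <- G & `[< cone c p >]].

Lemma derivativeP M (G : seq (seq M)) p m :
  fan (derivative G p) m <-> eventually (fun t => fan G (p + t *: m)).
Proof.
split.
  move=> [c1 /mapP[c]]; rewrite mem_filter => /andP[/asboolP cp cG] ->.
  move=> /cone_cons[b b0 cm].
  have := eventually_pos (- b) (@ltr01 R); apply: eventuallyW => t t0 tb.
  exists c => //.
  have -> : p + t *: m = (1 + t * - b) *: p + t *: (m - b *: - p).
    rewrite scalerBr scalerN scalerN opprK scalerA scalerDl scale1r mulrN scaleNr.
    by rewrite -addrA; congr (_ + _); rewrite addrCA addNr addr0.
  by apply: coneD; apply: coneZ => //; rewrite ltW.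
move=> /eventually_frequently /frequently_pigeonhole[c cG /cone_ray_closed].
move=> [al [be [e [pE mE e0 abe]]]].
have cp : cone c p.
  pose a i := al i + 0 * be i; exists a.
    by move=> i; apply: abe; rewrite lexx ltW.
  by rewrite pE; apply: eq_bigr => i _; rewrite /a mul0r addr0.
have cpm : cone c (p + e *: m).
  pose a i := al i + e * be i; exists a.
    by move=> i; apply: abe; rewrite lexx ltW.
  rewrite pE mE scaler_sumr -big_split; apply: eq_bigr => i _ /=.
  by rewrite scalerA scalerDl.
exists (- p :: c).
  by apply: map_f; rewrite mem_filter cG andbT; apply/asboolP.
apply/cone_cons; exists e^-1; first by rewrite invr_ge0 ltW.
rewrite scalerN opprK.
have -> : m + e^-1 *: p = e^-1 *: (p + e *: m).
  by rewrite scalerDr scalerA mulVf ?gt_eqF // scale1r addrC.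
by apply: coneZ cpm; rewrite invr_ge0 ltW.
Qed.

Definition tangent E (D : E -> Prop) (x w : E) : Prop :=
  eventually (fun t => D (x + t *: w)).

(** The graph of a positively homogeneous piecewise linear bijection from [D] onto
    the whole space [F]. *)
Record chart E F (D : E -> Prop) (G : seq (seq (E * F)%type)) : Prop := Chart {
  chart_dom : forall x y, fan G (x, y) -> D x;
  chart_fun : forall x, D x -> exists y, fan G (x, y);
  chart_onto : forall y, exists x, fan G (x, y);
  chart_eq : forall x y y', fan G (x, y) -> fan G (x, y') -> y = y';
  chart_inj : forall x x' y, fan G (x, y) -> fan G (x', y) -> x = x' }.

(** The common part of the two halves of [chart_derivative], with [h] one of the two
    projections: a ray at [h p] that stays in the image of [G] lifts to a ray at
    [p]. The generators of one cone of [G] lift the affine coefficients, and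
    injectivity of [h] at [p] ensures that the lifted ray starts at [p]. *)
Lemma fan_lift_ray M E (h : {linear M -> E}) (G : seq (seq M)) p w :
  fan G p -> (forall m, fan G m -> h m = h p -> m = p) ->
  frequently (fun t => exists2 m, fan G m & h m = h p + t *: w) ->
  exists2 m, fan (derivative G p) m & h m = w.
Proof.
move=> Gp hinj hf.
have [c cG] : exists2 c, c \in G &
    frequently (fun t => cone (map h c) (h p + t *: w)).
  apply: frequently_pigeonhole => e /hf[t te [m [c cG cm] hm]].
  by exists t => //; exists c => //; rewrite -hm; apply: cone_image.
move=> /cone_ray_closed[al [be [e [pE wE e0 abe]]]].
have himage (a : nat -> R) : h (\sum_(i < size c) a i *: c`_i) =
    \sum_(i < size (map h c)) a i *: (map h c)`_i.
  rewrite size_map linear_sum; apply: eq_bigr => i _.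
  by rewrite linearZ /= (nth_map 0).
pose m := \sum_(i < size c) be i *: c`_i.
have eqp : \sum_(i < size c) al i *: c`_i = p.
  apply: hinj; last by rewrite himage -pE.
  exists c => //; exists (fun i => al i + 0 * be i).
    by move=> i; apply: abe; rewrite lexx ltW.
  by apply: eq_bigr => i _; rewrite mul0r addr0.
exists m; last by rewrite himage -wE.
apply/derivativeP; exists e => // t /andP[t0 te]; exists c => //.
exists (fun i => al i + t * be i).
  by move=> i; apply: abe; rewrite te ltW.
rewrite -eqp scaler_sumr -big_split; apply: eq_bigr => i _ /=.
by rewrite scalerA scalerDl.
Qed.

(** The derivative of a chart is a chart: rays lift in both directions, and two rays
    at the same point of the graph with the same projection agree. *)
Lemma chart_derivative E F (D : E -> Prop) (G : seq (seq (E * F)%type)) x0 y0 :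
  chart D G -> fan G (x0, y0) -> chart (tangent D x0) (derivative G (x0, y0)).
Proof.
move=> [cdom cfun conto ceq cinj] G0; split.
- move=> x y /derivativeP; apply: eventuallyW => t _; exact: cdom.
- move=> w wD; have [|||[w' z] Gm /= <-] :=
    @fan_lift_ray _ _ (fst : {linear (E * F)%type -> E}) G (x0, y0) w; last by exists z.
  + by [].
  + by move=> [x y] Gm /= xx; rewrite xx in Gm *; rewrite (ceq _ _ _ Gm G0).
  + apply: eventually_frequently; apply: eventuallyW wD => t _ /cfun[y Gy].
    by exists (x0 + t *: w, y).
- move=> z; have [|||[w z'] Gm /= <-] :=
    @fan_lift_ray _ _ (snd : {linear (E * F)%type -> F}) G (x0, y0) z; last by exists w.
  + by [].
  + by move=> [x y] Gm /= xx; rewrite xx in Gm *; rewrite (cinj _ _ _ Gm G0).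
  + apply: eventually_frequently; apply: eventually_true => t _.
    by have [x Gx] := conto (y0 + t *: z); exists (x, y0 + t *: z).
- move=> x y y' /derivativeP h /derivativeP h'.
  have [t t0 [Gm Gm']] := eventually_ex (eventually_and h h').
  have /addrI : y0 + t *: y = y0 + t *: y' by apply: ceq Gm Gm'.
  by apply: scalerI; rewrite gt_eqF.
- move=> x x' y /derivativeP h /derivativeP h'.
  have [t t0 [Gm Gm']] := eventually_ex (eventually_and h h').
  have /addrI : x0 + t *: x = x0 + t *: x' by apply: cinj Gm Gm'.
  by apply: scalerI; rewrite gt_eqF.
Qed.

Definition lineality M (G : seq (seq M)) (l : M) : Prop :=
  forall m s, fan G m -> fan G (m + s *: l).

Lemma lineality_derivative M (G : seq (seq M)) p l :
  lineality G l -> lineality (derivative G p) l.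
Proof.
move=> Gl m s /derivativeP Gm; apply/derivativeP; apply: eventuallyW Gm => t _.
by rewrite scalerDr addrA scalerA; apply: Gl.
Qed.

Lemma lineality_derivative_point M (G : seq (seq M)) p :
  lineality (derivative G p) p.
Proof.
move=> m s [c1 /mapP[c cG ->] cm]; exists (- p :: c); first exact: map_f.
move: cG; rewrite mem_filter => /andP[/asboolP cp _].
apply: coneD => //; have [s0|s0] := leP 0 s.
  by apply/cone_cons; exists 0 => //; rewrite scale0r subr0; apply: coneZ.
apply/cone_cons; exists (- s); first by lra.
by rewrite scaleNr scalerN opprK subrr; apply: cone0.
Qed.

Lemma linealityD M (G : seq (seq M)) l l' :
  lineality G l -> lineality G l' -> lineality G (l + l').
Proof. by move=> h h' m s Gm; rewrite scalerDr addrA; apply/h'/h. Qed.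

Lemma linealityZ M (G : seq (seq M)) a l : lineality G l -> lineality G (a *: l).
Proof. by move=> h m s Gm; rewrite scalerA; apply: h. Qed.

Lemma lineality_sum M (G : seq (seq M)) (I : finType) (P : pred I) (l : I -> M) :
  (forall i, P i -> lineality G (l i)) -> lineality G (\sum_(i | P i) l i).
Proof.
move=> h; elim/big_rec: _ => [|i x Pi hx]; last exact: linealityD (h i Pi) hx.
by move=> m s; rewrite scaler0 addr0.
Qed.

End Fans.

(** * Links in a clique complex that is a sphere *)

Lemma chart_ext (R : realFieldType) (E F : lmodType R) (D D' : E -> Prop)
    (G : seq (seq (E * F)%type)) :
  (forall x, D x <-> D' x) -> chart D G -> chart D' G.
Proof.
move=> eqD [cdom cfun conto ceq cinj]; split=> //.
- by move=> x y /cdom/eqD.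
- by move=> x /eqD/cfun.
Qed.

(** The connectedness of the unit interval, in the form that is used for paths. *)
Lemma locally_constant_unit (R : realType) (Q : R -> Prop) :
  (forall t, 0 <= t <= 1 -> exists2 e, 0 < e &
     forall s, 0 <= s <= 1 -> `|s - t| < e -> (Q s <-> Q t)) ->
  Q 0 -> Q 1.
Proof.
move=> loc Q0; pose S : set R := fun t => 0 <= t <= 1 /\ forall s, 0 <= s <= t -> Q s.
have S0 : S 0.
  split; first by rewrite lexx ler01.
  by move=> s; rewrite -eq_le => /eqP <-.
have Sub : ubound S 1 by move=> t [/andP[]].
have hS : has_sup S by split; [exists 0 | exists 1].
set m := sup S.
have m01 : 0 <= m <= 1.
  by rewrite ub_le_sup ?ge_sup //; [exists 0 | exists 1].
have [e e0 he] := loc m m01.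
have [t St tm] := sup_adherent e0 hS.
rewrite -/m in tm; have tlem : t <= m by apply: ub_le_sup => //; exists 1.
have Qm : Q m.
  case: St => t01 Qt; apply/(he t t01); last by apply: Qt; lra.
  by rewrite ltr_norml; lra.
have Sm s : 0 <= s -> s <= 1 -> s < m + e -> Q s.
  move=> s0 s1 sm; have [st|st] := leP s t.
    by case: St => _; apply; rewrite s0.
  by apply/(he s); rewrite ?s0 ?ltr_norml //; lra.
apply/Sm => //; rewrite ltNge; apply/negP => me1.
have : S (m + e / 2).
  split; first by lra.
  by move=> s /andP[s0 sm]; apply: Sm => //; lra.
by move=> /(ub_le_sup (ex_intro _ 1 Sub)); rewrite -/m; lra.
Qed.

Section LocalSpheres.
Variables (R : realType) (T : finType) (e : rel T).
Hypothesis esym : symmetric e.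
Notation E := (coord_space R T).
Implicit Types (A B s : {set T}) (x : E) (u v w : T).

Definition delta u : E := [ffun v => (v == u)%:R].

(** The product of the space spanned by [s] and the cone over the clique complex of
    [A]. It occurs as an iterated tangent cone, with [s] a clique and [A] the common
    neighbours of its vertices. *)
Definition link_domain s A x : Prop :=
  [/\ forall u, u \notin s -> 0 <= x u,
      forall u, u \notin s -> x u != 0 -> u \in A
    & forall u v, u \notin s -> v \notin s -> x u != 0 -> x v != 0 ->
        u = v \/ e u v].

Lemma delta_domain s A u : u \in A -> link_domain s A (delta u).
Proof.
move=> uA; have du v : delta u v != 0 -> v = u.
  by rewrite ffunE; have [//|_] := eqVneq v u; rewrite eqxx.
split=> [v _|v _ /du->//|v w _ _ /du-> /du->]; last by left.
by rewrite ffunE ler0n.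
Qed.

Definition link A v := [set u in A | (u != v) && e v u]%SET.

(** Near [delta v] the coordinate at [v] is positive, which leaves it free to vary
    and confines the other coordinates to neighbours of [v]. *)
Lemma tangent_link_domain s A v (w : E) : v \in A -> [disjoint s & A] ->
  tangent (link_domain s A) (delta v) w <-> link_domain (v |: s)%SET (link A v) w.
Proof.
move=> vA dis.
have vs : v \notin s by rewrite (disjointFl dis).
have vpos : eventually (fun t => 0 < (delta v + t *: w) v).
  by apply: eventuallyW (eventually_pos (w v) (@ltr01 R)) => t _; rewrite !ffunE eqxx.
have val t u : u != v -> (delta v + t *: w) u = t * w u.
  by move=> uv; rewrite !ffunE (negbTE uv) add0r.
split=> [tw|[pw sw cw]].
  have [t t0 [[pt st ct] vt]] := eventually_ex (eventually_and tw vpos).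
  have nz u : u != v -> w u != 0 -> (delta v + t *: w) u != 0.
    by move=> uv wu; rewrite val // mulf_neq0 // gt_eqF.
  split=> [u|u|u u']; rewrite !in_setU1 !negb_or => /andP[uv us].
  - by have := pt u us; rewrite val // pmulr_rge0.
  - move=> wu; rewrite finset.inE uv (st u us) ?nz //=.
    case: (ct v u vs us _ (nz u uv wu)) => [|vu|//]; first by rewrite gt_eqF.
    by rewrite vu eqxx in uv.
  - by move=> /andP[u'v u's] wu wu'; apply: ct => //; apply: nz.
apply: eventuallyW vpos => t t0 vt.
have supp u : u \notin s -> (delta v + t *: w) u != 0 -> u = v \/ u != v /\ w u != 0.
  have [->|uv] := eqVneq u v; first by left.
  move=> us; rewrite val // => h; right; split=> //.
  by apply: contraNneq h => ->; rewrite mulr0.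
have sA u : u != v -> u \notin s -> w u != 0 -> u \in link A v.
  by move=> uv us wu; apply: sw; rewrite // in_setU1 negb_or uv.
split=> [u us|u us /(supp u us)|u u' us u's /(supp u us) + /(supp u' u's)].
- have [->|uv] := eqVneq u v; first exact: ltW.
  by rewrite val // mulr_ge0 ?(ltW t0) // pw // in_setU1 negb_or uv.
- by case=> [->//|[uv wu]]; have := sA u uv us wu; rewrite finset.inE => /andP[].
- case=> [->|[uv wu]] [->|[u'v wu']]; first by left.
  + by right; have := sA u' u'v u's wu'; rewrite finset.inE => /and3P[].
  + by right; have := sA u uv us wu; rewrite finset.inE esym => /and3P[].
  + by apply: cw => //; rewrite in_setU1 negb_or ?uv ?u'v.
Qed.

(** When [s] is a clique and [A] its link, this is what remains of the property that
    the link is a PL sphere; passing to the quotient of [F] by the image of the span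
    of [s] is avoided by keeping track of the translations. *)
Definition local_sphere (F : lmodType R) s A : Prop :=
  [disjoint s & A] /\ exists G : seq (seq (E * F)%type),
    chart (link_domain s A) G /\ forall v, v \in s -> exists y, lineality G (delta v, y).

Lemma local_sphere_link F s A v : v \in A ->
  local_sphere F s A -> local_sphere F (v |: s)%SET (link A v).
Proof.
move=> vA [dis [G [cG linG]]]; split.
  apply/pred0P => u; apply/negP => /= /andP[].
  rewrite in_setU1 finset.inE => + /and3P[uA uv _].
  by rewrite (negbTE uv) (disjointFl dis uA).
have [y Gy] := chart_fun cG (delta_domain s vA).
exists (derivative G (delta v, y)); split.
  by apply: chart_ext (chart_derivative cG Gy) => w; apply: tangent_link_domain.
move=> u; rewrite in_setU1 => /orP[/eqP->|/linG[z lz]].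
  by exists y; apply: lineality_derivative_point.
by exists z; apply: lineality_derivative.
Qed.

Section Chart.
Variables (F : lmodType R) (s A : {set T}) (G : seq (seq (E * F)%type)).
Hypothesis dis : [disjoint s & A].
Hypothesis cG : chart (link_domain s A) G.
Hypothesis linG : forall v, v \in s -> exists y, lineality G (delta v, y).

Let notin_s u : u \in A -> u \notin s.
Proof. by move=> uA; rewrite (disjointFl dis). Qed.

Definition flat x := forall u, u \notin s -> x u = 0.

Lemma flat_lineality x : flat x -> exists y, lineality G (x, y).
Proof.
move=> fx.
have [y linGy] : exists y : T -> F, forall v, v \in s -> lineality G (delta v, y v).
  apply: (fin_all_exists (P := fun v y => v \in s -> lineality G (delta v, y))) => v.
  by case: (boolP (v \in s)) => [/linG[y]|_]; [exists y | exists 0].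
exists (\sum_(v in s) x v *: y v).
suff -> : (x, \sum_(v in s) x v *: y v) =
    \sum_(v in s) (x v : R) *: ((delta v, y v) : (E * F)%type).
  by apply: lineality_sum => v vs; apply: linealityZ; apply: linGy.
have h : x = \sum_(v in s) (x v : R) *: delta v.
  apply/ffunP => u; rewrite sum_ffunE.
  under eq_bigr do rewrite !ffunE.
  have [us|us] := boolP (u \in s); last first.
    rewrite fx // big1 // => v vs; case: eqP => [uv|_]; last exact: mulr0.
    by rewrite -uv (negbTE us) in vs.
  rewrite (bigD1 u) //= eqxx big1 ?addr0; first by rewrite [RHS]mulr1.
  by move=> v /andP[_ vu]; rewrite eq_sym (negbTE vu) [LHS]mulr0.
by rewrite [RHS]surjective_pairing !raddf_sum; congr pair.
Qed.

(** The image in [F] of the span of [s]; it is a linear subspace. *)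
Definition shadow (y : F) : Prop := exists2 x, flat x & lineality G (x, y).

Lemma fan_add x y x' y' t : fan G (x, y) -> lineality G (x', y') ->
  fan G (x + t *: x', y + t *: y').
Proof. by move=> Gxy /(_ _ t Gxy). Qed.

Lemma shadowD y y' : shadow y -> shadow y' -> shadow (y + y').
Proof.
move=> [x fx Gx] [x' fx' Gx']; exists (x + x').
  by move=> u us; rewrite ffunE fx // fx' // addr0.
by rewrite (_ : (_, _) = (x, y) + (x', y')) //; apply: linealityD.
Qed.

Lemma shadowZ a y : shadow y -> shadow (a *: y).
Proof.
move=> [x fx Gx]; exists (a *: x).
  by move=> u us; rewrite ffunE fx // scaler0.
by rewrite (_ : (_, _) = a *: ((x, y) : (E * F)%type)) //; apply: linealityZ.
Qed.

Lemma shadowN y : shadow (- y) -> shadow y.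
Proof. by move=> /(shadowZ (- 1)); rewrite scaleN1r opprK. Qed.

Lemma shadow_scale a y : a != 0 -> shadow (a *: y) -> shadow y.
Proof. by move=> a0 /(shadowZ a^-1); rewrite scalerA mulVf // scale1r. Qed.

Lemma fan00 : fan G (0, 0).
Proof.
have [|y Gy] := chart_fun cG (_ : link_domain s A 0).
  by split=> [u _|u _|u v _ _]; rewrite ffunE ?eqxx.
by have := fanZ (lexx 0) Gy; rewrite (_ : 0 *: _ = (0, 0)) // -[RHS](scale0r (0, y)).
Qed.

Lemma shadow_flat x y : fan G (x, y) -> shadow y -> flat x.
Proof.
move=> Gxy [x' fx' lin']; have := fan_add 1 fan00 lin'.
by rewrite !scale1r !add0r => Gx'; rewrite (chart_inj cG Gxy Gx').
Qed.

Lemma delta_fan u : u \in A -> exists y, fan G (delta u, y).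
Proof. by move=> uA; apply: (chart_fun cG); apply: delta_domain. Qed.

Lemma delta_not_flat u : u \in A -> ~ flat (delta u).
Proof. by move=> /notin_s us /(_ u us) /eqP; rewrite ffunE eqxx oner_eq0. Qed.

Lemma delta_not_shadow u y : u \in A -> fan G (delta u, y) -> ~ shadow y.
Proof. by move=> /delta_not_flat uA Gu /(shadow_flat Gu). Qed.

(** Modulo the shadow, distinct elements of [A] are sent to distinct rays. *)
Lemma same_ray u v yu yv t : u \in A -> v \in A -> 0 <= t ->
  fan G (delta u, yu) -> fan G (delta v, yv) -> shadow (yu - t *: yv) -> u = v.
Proof.
move=> uA vA t0 Gu /(fanZ t0) Gv [x fx linx].
have := fan_add 1 Gv linx; rewrite /= !scale1r [t *: yv + _]addrC subrK => Gu'.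
have := chart_inj cG Gu Gu' => /ffunP/(_ u); rewrite !ffunE eqxx fx ?notin_s //.
rewrite addr0; have [//|_] := eqVneq u v.
by rewrite scaler0 => /eqP; rewrite oner_eq0.
Qed.

(** If [u] were the only element, the preimage of [- y], with [y] the image of
    [delta u], would be a nonnegative multiple of [delta u] modulo the span of [s];
    then [y] would be in the shadow. *)
Lemma not_singleton u : A <> [set u]%SET.
Proof.
move=> Au; have uA : u \in A by rewrite Au finset.inE.
have us := notin_s uA.
have [y Gu] := delta_fan uA.
have [x Gx] := chart_onto cG (- y).
have [xpos xsupp _] := chart_dom cG Gx.
have fl : flat (x - x u *: delta u).
  move=> v vs; rewrite !ffunE; have [->|vu] := eqVneq v u.
    by rewrite [_ *: _]mulr1 subrr.
  rewrite [_ *: _]mulr0 subr0; apply/eqP; apply: contraNT vu => /(xsupp v vs).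
  by rewrite Au finset.inE.
have [y' lin'] := flat_lineality fl.
have := fan_add 1 (fanZ (xpos u us) Gu) lin'.
rewrite /= !scale1r [x u *: _ + (_ - _)]addrC subrK => Gx'.
have eqy := chart_eq cG Gx Gx'.
apply: (delta_not_shadow uA Gu); apply: (@shadow_scale (1 + x u)).
  by rewrite gt_eqF // ltr_wpDr ?xpos.
apply: shadowN; exists (x - x u *: delta u) => //.
suff -> : - ((1 + x u) *: y) = y' by [].
by rewrite scalerDl scale1r opprD eqy addrAC subrr add0r.
Qed.

(** In this section the link [A] falls apart into [B] and its complement.  Since a
    clique lies on one side, a path in [F] that avoids the shadow of the flat part
    cannot change sides. *)
Section Separation.
Variable B : {set T}.
Hypothesis sBA : B \subset A.
Hypothesis sepB : forall u v, u \in B -> v \in A -> v \notin B -> ~~ e u v.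

Definition meets_B x := exists2 u, u \in B & x u != 0.

(** Nonzero coordinates outside [s] stay nonzero for a short time, and a clique that
    contains an element outside [B] does not meet [B]. *)
Lemma meets_B_local x y z : fan G (x, y) -> ~ flat x ->
  eventually (fun t => forall x', fan G (x', y + t *: z) -> meets_B x' <-> meets_B x).
Proof.
move=> Gxy nfx.
have [w Gw] := chart_onto (chart_derivative cG Gxy) z.
move/derivativeP: Gw => Gw.
have [u us xu] : exists2 u, u \notin s & x u != 0.
  apply: contrapT => h; apply: nfx => u us; apply/eqP; apply/negPn/negP => xu.
  by apply: h; exists u.
have [xpos xsupp xcl] := chart_dom cG Gxy.
have : eventually (fun t => forall v : T, v \notin s -> x v != 0 -> (x + t *: w) v != 0).
  apply: eventually_forall => v; have [vs|vs] := boolP (v \in s).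
    exact: eventually_true.
  have [xv|xv] := eqVneq (x v) 0; first exact: eventually_true.
  have x0 : 0 < x v by rewrite lt_def xv xpos.
  apply: eventuallyW (eventually_pos (w v) x0) => t _ h _ _.
  by rewrite !ffunE gt_eqF.
move=> /(eventually_and Gw); apply: eventuallyW => t _ [Gt nz] x' Gx'.
rewrite (chart_inj cG Gx' Gt); have [_ ysupp ycl] := chart_dom cG Gt.
split; last first.
  by move=> [v vB xv]; exists v => //; apply: nz => //; apply/notin_s/(fintype.subsetP sBA).
move=> [v vB yv]; have uA := xsupp u us xu; exists u => //.
apply: contrapT => /negP uB.
have vA : v \in A by apply: (fintype.subsetP sBA).
have [vu|] := ycl v u (notin_s vA) us yv (nz u us xu).
  by rewrite -vu vB in uB.
by apply/negP; apply: sepB.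
Qed.

Lemma meets_B_segment x0 y0 x1 y1 : fan G (x0, y0) -> fan G (x1, y1) ->
  (forall t, 0 <= t <= 1 -> ~ shadow ((1 - t) *: y0 + t *: y1)) ->
  meets_B x0 -> meets_B x1.
Proof.
move=> G0 G1 nsh m0.
pose y t := (1 - t) *: y0 + t *: y1.
pose Q t := exists2 x, fan G (x, y t) & meets_B x.
have yL t : y t = y0 + t *: (y1 - y0).
  by rewrite /y scalerBl scale1r scalerBr -addrA [- _ + _]addrC.
have yE t (t' : R) : y t' = y t + (t' - t) *: (y1 - y0).
  by rewrite !yL -addrA -scalerDl [t + _]addrC subrK.
suff : Q 1.
  move=> [x]; rewrite /y subrr scale0r add0r scale1r => Gx.
  by rewrite (chart_inj cG Gx G1).
apply: locally_constant_unit; last first.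
  by exists x0; rewrite // /y subr0 scale0r addr0 scale1r.
move=> t t01; have [x Gx] := chart_onto cG (y t).
have nfx : ~ flat x.
  move=> fx; have [y' lin'] := flat_lineality fx; apply: (nsh t t01); exists x => //.
  have := fan_add 1 fan00 lin'; rewrite !scale1r !add0r => Gx'.
  by rewrite -/(y t) (chart_eq cG Gx Gx').
have QtE : Q t <-> meets_B x.
  by split=> [[x' Gx']|]; [rewrite (chart_inj cG Gx' Gx) | exists x].
have [r r0 hr] := eventually_and (meets_B_local (y1 - y0) Gx nfx)
  (meets_B_local (- (y1 - y0)) Gx nfx).
exists r => // t' _ st; rewrite QtE.
have [x' Gx'] := chart_onto cG (y t').
have -> : Q t' <-> meets_B x'.
  by split=> [[x2 Gx2]|]; [rewrite (chart_inj cG Gx2 Gx') | exists x'].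
have := Gx'; rewrite (yE t); have [ts|ts|ts] := ltgtP t t'.
- by apply: (hr (t' - t) _).1; move: st; rewrite ltr_norml; lra.
- rewrite -opprB scaleNr -scalerN.
  by apply: (hr (t - t') _).2; move: st; rewrite ltr_norml; lra.
- by rewrite -ts subrr scale0r addr0 => Gx2; rewrite (chart_inj cG Gx2 Gx).
Qed.

(** A segment from the image of [delta a] to that of [delta b] meets the shadow, and
    so do all detours; hence the shadow is a hyperplane, and each side of it can
    only hold one ray. *)
Lemma separated_pair a b : a \in B -> b \in A -> b \notin B -> A = [set a; b]%SET.
Proof.
move=> aB bA bB; have aA := fintype.subsetP sBA a aB.
have [ya Ga] := delta_fan aA; have [yb Gb] := delta_fan bA.
have nsa := delta_not_shadow aA Ga; have nsb := delta_not_shadow bA Gb.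
have ma : meets_B (delta a) by exists a; rewrite // ffunE eqxx oner_eq0.
have nmb : ~ meets_B (delta b).
  move=> [u uB]; rewrite ffunE; have [ub|_] := eqVneq u b; last by rewrite eqxx.
  by rewrite -ub uB in bB.
pose line (w : F) := exists r, shadow (w - r *: ya).
have segl (w : F) : ~ line w -> forall t, 0 <= t <= 1 -> ~ shadow ((1 - t) *: ya + t *: w).
  move=> nl t t01 sh; have [t0|t0] := eqVneq t 0.
    by apply: nsa; move: sh; rewrite t0 subr0 scale0r addr0 scale1r.
  apply: nl; exists (- ((1 - t) / t)); apply: (shadow_scale t0).
  by rewrite scaleNr opprK scalerDr scalerA mulrC divfK // addrC.
have lb : line yb.
  apply: contrapT => nl; apply: nmb; exact: meets_B_segment Ga Gb (segl _ nl) ma.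
(* Otherwise [ya] and [yb] are joined by a path through [w] that avoids the
   shadow. *)
have lineall (w : F) : line w.
  apply: contrapT => nl; have [x Gx] := chart_onto cG w.
  have mx := meets_B_segment Ga Gx (segl _ nl) ma.
  apply: nmb; apply: (meets_B_segment Gx Gb) mx => t t01 sh.
  have [t1|t1] := eqVneq (1 - t) 0.
    apply: nsb; move: sh; rewrite t1 scale0r add0r.
    by apply: shadow_scale; apply/eqP; lra.
  case: lb => r shr; apply: nl; exists (- (t * r / (1 - t))).
  apply: (shadow_scale t1); rewrite scaleNr opprK scalerDr scalerA.
  rewrite [(1 - t) * _]mulrC divfK // -scalerA.
  have -> : (1 - t) *: w + t *: (r *: ya) =
     ((1 - t) *: w + t *: yb) + (- t) *: (yb - r *: ya).
    by rewrite scalerBr !scaleNr opprK addrA addrK.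
  by apply: shadowD => //; apply: shadowZ.
have negline u yu r : u \in A -> u != a -> fan G (delta u, yu) ->
    shadow (yu - r *: ya) -> r < 0.
  move=> uA ua Gu sh; rewrite ltNge; apply/negP => r0.
  by rewrite (same_ray uA aA r0 Gu Ga sh) eqxx in ua.
have ba : b != a by apply: contraNneq bB => ->.
(* Modulo the shadow, [F] is a line: [a] spans one of its rays and all other
   elements of [A] span the opposite one. *)
have [rb shb] := lb; have rb0 := negline b yb rb bA ba Gb shb.
apply/setP => u; rewrite !finset.inE; apply/idP/orP => [uA|[]/eqP->//].
have [//|ua] := eqVneq u a; [by left|right].
have [yu Gu] := delta_fan uA; have [ru shu] := lineall yu.
have ru0 := negline u yu ru uA ua Gu shu.
apply/eqP; apply: (@same_ray u b yu yb (ru / rb)) => //.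
  by rewrite mulr_le0 // ?invr_le0 ltW.
have -> : yu - (ru / rb) *: yb = (yu - ru *: ya) + (- (ru / rb)) *: (yb - rb *: ya).
  by rewrite scalerBr !scaleNr opprK scalerA divfK ?lt_eqF // [- _ + _]addrC addrA subrK.
by apply: shadowD => //; apply: shadowZ.
Qed.

End Separation.
End Chart.

Lemma local_sphere_not_singleton F s A u : local_sphere F s A -> A <> [set u]%SET.
Proof. by move=> [dis [G [cG linG]]]; apply: not_singleton cG linG _. Qed.

Lemma local_sphere_separated F s A B a b : local_sphere F s A -> B \subset A ->
  (forall u v, u \in B -> v \in A -> v \notin B -> ~~ e u v) ->
  a \in B -> b \in A -> b \notin B -> A = [set a; b]%SET.
Proof.
by move=> [dis [G [cG linG]]] sBA sepB; apply: separated_pair cG linG _ sBA sepB _ _.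
Qed.

End LocalSpheres.

(** * The cone over a piecewise linear sphere *)

Section AffineHull.
Variable R : realType.
Implicit Types E F : lmodType R.

Lemma conv_hullP E (s : seq E) x : conv_hull s x <->
  exists a : nat -> R, [/\ forall i, 0 <= a i, \sum_(i < size s) a i = 1
    & x = \sum_(i < size s) a i *: s`_i].
Proof.
split=> [[a [a0 a1 ->]]|[a [a0 a1 ->]]].
  exists (fun k => if insub k is Some i then a i else 0); split.
  - by move=> k; case: insubP.
  - by rewrite -[RHS]a1; apply: eq_bigr => i _; rewrite valK.
  - by apply: eq_bigr => i _; rewrite valK (tnth_nth 0).
exists (fun i => a i); split=> //.
by apply: eq_bigr => i _; rewrite (tnth_nth 0).
Qed.

Lemma conv_hull_convex E (s : seq E) x y t : conv_hull s x -> conv_hull s y ->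
  0 <= t <= 1 -> conv_hull s (t *: x + (1 - t) *: y).
Proof.
move=> [a [a0 a1 ->]] [b [b0 b1 ->]] /andP[t0 t1].
exists (fun i => t * a i + (1 - t) * b i)%R; split.
- by move=> i; rewrite addr_ge0 // mulr_ge0 // subr_ge0.
- by rewrite big_split -!mulr_sumr a1 b1 !mulr1 /= addrC subrK.
- rewrite !scaler_sumr -big_split /=; apply: eq_bigr => i _.
  by rewrite [RHS]scalerDl !scalerA.
Qed.

Lemma conv_hull_mem E (s : seq E) i : (i < size s)%N -> conv_hull s s`_i.
Proof.
move=> lt_is; apply/conv_hullP; exists (fun j => (j == i)%:R); split.
- by move=> j; rewrite ler0n.
- rewrite (bigD1 (Ordinal lt_is)) //= eqxx big1 ?addr0 // => j.
  by rewrite -val_eqE /= => /negbTE ->.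
- rewrite (bigD1 (Ordinal lt_is)) //= eqxx scale1r big1 ?addr0 // => j.
  by rewrite -val_eqE /= => /negbTE ->; rewrite scale0r.
Qed.

(** An affine map commutes with convex combinations of any length; stated for
    unnormalized coefficients, which is the form needed for cones. *)
Lemma affine_on_sum E F (s : seq E) (f : E -> F) (n : nat) (a : nat -> R)
    (z : nat -> E) :
  affine_on (conv_hull s) f -> (forall i, 0 <= a i) ->
  (forall i, (i < n)%N -> conv_hull s (z i)) ->
  let r := \sum_(i < n) a i in 0 < r ->
  conv_hull s (r^-1 *: \sum_(i < n) a i *: z i) /\
  \sum_(i < n) a i *: f (z i) = r *: f (r^-1 *: \sum_(i < n) a i *: z i).
Proof.
move=> aff a0 hz; elim: n hz => [|n IH] hz /=; first by rewrite big_ord0 ltxx.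
rewrite !big_ord_recr /=; set r := \sum_(i < n) a i.
have {}IH := IH (fun i lt_in => hz i (leqW lt_in)); rewrite -/r /= in IH.
have hn := hz n (ltnSn n).
have r0 : 0 <= r by apply: sumr_ge0.
have [rz|rz] := eqVneq r 0.
  have zz : forall i : 'I_n, a i = 0.
    by move=> i; apply/(psumr_eq0P _ rz).
  rewrite rz add0r => an; rewrite big1 ?add0r; last by move=> i _; rewrite zz scale0r.
  rewrite big1 ?add0r; last by move=> i _; rewrite zz scale0r.
  by rewrite scalerA mulVf ?gt_eqF // scale1r.
have rp : 0 < r by rewrite lt_def rz.
have [hu fu] := IH rp; set u := r^-1 *: _ in hu fu.
move=> ra.
have eqx : (r + a n)^-1 *: (\sum_(i < n) a i *: z i + a n *: z n) =
   (r / (r + a n)) *: u + (1 - r / (r + a n)) *: z n.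
  have -> : 1 - r / (r + a n) = (r + a n)^-1 * a n by field; rewrite gt_eqF.
  rewrite /u scalerDr !scalerA; congr (_ *: _ + _).
  by field; rewrite !gt_eqF.
have t01 : 0 <= r / (r + a n) <= 1.
  by rewrite divr_ge0 ?(ltW ra) //= ler_pdivrMr // mul1r lerDl.
rewrite eqx; split; first exact: conv_hull_convex.
rewrite aff // fu scalerDr !scalerA; congr (_ *: _ + _ *: _).
  by field; rewrite gt_eqF.
by field; rewrite gt_eqF.
Qed.

End AffineHull.

Section SphereChart.
Variables (R : realType) (n : nat).
Notation E' := (coord_space R 'I_n.+1).
Notation F := (coord_space R 'I_n).

Definition boundary_cone (y : E') : Prop :=
  (forall i, 0 <= y i) /\ exists i, y i = 0.

(** The quotient by the diagonal; it is bijective on the cone over the boundary of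
    the simplex ([mod_diagonal_inj], [mod_diagonal_onto]), which thereby becomes a
    vector space. *)
Definition mod_diagonal (y : E') : F := [ffun i => y (lift ord0 i) - y ord0].

Fact mod_diagonal_linear : linear mod_diagonal.
Proof.
move=> a x y; apply/ffunP => i; rewrite !ffunE [a *: _ in RHS]mulrBr.
by rewrite opprD addrACA.
Qed.

HB.instance Definition _ :=
  GRing.isLinear.Build R E' F _ mod_diagonal mod_diagonal_linear.

Lemma mod_diagonal_inj y y' : boundary_cone y -> boundary_cone y' ->
  mod_diagonal y = mod_diagonal y' -> y = y'.
Proof.
move=> [y0 [i yi]] [y'0 [j y'j]] /ffunP eqy.
have eqd k : y k - y ord0 = y' k - y' ord0.
  have [k' ->|->] := unliftP ord0 k; last by rewrite !subrr.
  by have := eqy k'; rewrite !ffunE.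
apply/ffunP => k.
by have := y0 j; have := y'0 i; have := eqd i; have := eqd j; have := eqd k; lra.
Qed.

Lemma mod_diagonal_onto z : exists2 y, boundary_cone y & mod_diagonal y = z.
Proof.
pose w : E' := [ffun i => if unlift ord0 i is Some j then z j else 0].
have [i _ mini] := arg_minP (fun i => w i : R) (isT : xpredT (ord0 : 'I_n.+1)).
exists [ffun j => w j - w i].
  split=> [j|]; first by rewrite ffunE subr_ge0 mini.
  by exists i; rewrite ffunE subrr.
by apply/ffunP => j; rewrite !ffunE liftK unlift_none sub0r opprK subrK.
Qed.

Lemma simplex_boundaryP y r : 0 < r ->
  realization R (simplex_boundary n) (r^-1 *: y) <->
  boundary_cone y /\ \sum_i y i = r.
Proof.
move=> r0.
have nz i : ((r^-1 *: y) i != 0) = (y i != 0).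
  by rewrite ffunE mulf_eq0 invr_eq0 gt_eqF.
have sumE : \sum_i (r^-1 *: y) i = r^-1 * \sum_i y i.
  by rewrite mulr_sumr; apply: eq_bigr => i _; rewrite ffunE.
split=> [[pos]|[[pos [i yi]] sumy]].
  rewrite sumE finset.inE => sum1 /andP[_].
  rewrite -finset.subTset => /fintype.subsetPn[i _].
  rewrite finset.inE negbK; move: (nz i) => /[swap] -> /esym/negbFE /eqP yi.
  split; last by rewrite -[r]mulr1 -sum1 mulVKf ?gt_eqF.
  split; last by exists i.
  by move=> j; have := pos j; rewrite ffunE pmulr_rge0 ?invr_gt0.
split; first by move=> j; rewrite ffunE mulr_ge0 // invr_ge0 ltW.
  by rewrite sumE sumy mulVf ?gt_eqF.
rewrite finset.inE; apply/andP; split; last first.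
  rewrite -finset.subTset; apply/fintype.subsetPn; exists i => //.
  by rewrite finset.inE nz yi eqxx.
apply/finset.set0Pn; apply: contrapT => h; move: r0; rewrite -sumy big1 ?ltxx // => j _.
by apply/eqP/negPn/negP => yj; apply: h; exists j; rewrite finset.inE nz.
Qed.

End SphereChart.

Section CliqueComplex.
Variables (R : realType) (T : finType) (e : rel T).
Hypothesis erefl : reflexive e.
Variables (A : {set T}) (D : {set {set T}}).
Hypothesis DE : forall S : {set T}, S \in D <->
  [/\ S != finset.set0, S \subset A & forall u v, u \in S -> v \in S -> e u v].
Notation E := (coord_space R T).
Implicit Types (x : E) (u v : T).

Lemma clique_realizationP x r : 0 < r ->
  realization R D (r^-1 *: x) <-> link_domain e finset.set0 A x /\ \sum_u x u = r.
Proof.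
move=> r0.
have nz u : ((r^-1 *: x) u != 0) = (x u != 0).
  by rewrite ffunE mulf_eq0 invr_eq0 gt_eqF.
have sumE : \sum_u (r^-1 *: x) u = r^-1 * \sum_u x u.
  by rewrite mulr_sumr; apply: eq_bigr => u _; rewrite ffunE.
rewrite /realization.
have -> : [set u | (r^-1 *: x) u != 0]%SET = [set u | x u != 0]%SET.
  by apply/setP => u; rewrite !finset.inE nz.
split=> [[pos]|[[pos supp cl] sumx]].
  rewrite sumE => sum1 /DE[_ /fintype.subsetP sA cl].
  split; last by rewrite -[r]mulr1 -sum1 mulVKf ?gt_eqF.
  split=> [u _|u _ xu|u v _ _ xu xv].
  - by have := pos u; rewrite ffunE pmulr_rge0 ?invr_gt0.
  - by apply: sA; rewrite finset.inE.
  - by right; apply: cl; rewrite finset.inE.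
split; first by move=> u; rewrite ffunE mulr_ge0 ?invr_ge0 ?(ltW r0) ?pos ?finset.inE.
  by rewrite sumE sumx mulVf ?gt_eqF.
apply/DE; split.
- apply/finset.set0Pn; apply: contrapT => h; move: r0; rewrite -sumx big1 ?ltxx // => u _.
  by apply/eqP/negPn/negP => xu; apply: h; exists u; rewrite finset.inE.
- by apply/fintype.subsetP => u; rewrite finset.inE; apply: supp; rewrite finset.inE.
- move=> u v; rewrite !finset.inE => xu xv.
  by have [||->|//] := cl u v _ _ xu xv; rewrite ?finset.inE.
Qed.

Variables (n : nat).
Notation E' := (coord_space R 'I_n.+1).
Notation F := (coord_space R 'I_n).
Variables (f : E -> E') (g : E' -> E) (cs : seq (seq E)).
Notation X := (realization R D).
Notation S := (realization R (simplex_boundary n)).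
Hypothesis fXS : forall x, X x -> S (f x).
Hypothesis gSX : forall y, S y -> X (g y).
Hypothesis fK : forall x, X x -> g (f x) = x.
Hypothesis gK : forall y, S y -> f (g y) = y.
Hypothesis csE : forall x, X x <-> exists2 c, c \in cs & conv_hull c x.
Hypothesis faff : forall c, c \in cs -> affine_on (conv_hull c) f.

(** The homogeneous extension of [f] to the cones over [X] and [S]. *)
Let graph x y : Prop :=
  x = 0 /\ y = 0 \/ exists r : R, [/\ 0 < r, X (r^-1 *: x) & y = r *: f (r^-1 *: x)].

Let graph_pieces : seq (seq (E * F)%type) :=
  [::] :: [seq [seq (z, mod_diagonal (f z)) | z <- c] | c <- cs].

Let sum_cone0 m : @cone R (E * F)%type [::] m -> m = 0.
Proof. by move=> [a _ ->]; rewrite big_ord0. Qed.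

Let graphP x z : fan graph_pieces (x, z) <-> exists2 y, graph x y & mod_diagonal y = z.
Proof.
split.
  move=> [c]; rewrite inE => /orP[/eqP-> /sum_cone0[-> ->]|].
    by exists 0; [left | apply: linear0].
  move=> /mapP[{}c cc -> [a a0]]; rewrite size_map => xz.
  pose h z := (z, mod_diagonal (f z)) : (E * F)%type.
  have xE : x = \sum_(i < size c) a i *: c`_i.
    transitivity (x, z).1; first by [].
    by rewrite xz raddf_sum; apply: eq_bigr => i _; rewrite (nth_map 0).
  have zE : z = mod_diagonal (\sum_(i < size c) a i *: f c`_i).
    transitivity (x, z).2; first by [].
    rewrite xz linear_sum raddf_sum; apply: eq_bigr => i _; rewrite (nth_map 0) //=.
    by rewrite linearZ.
  exists (\sum_(i < size c) a i *: f c`_i) => //.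
  have r0 : 0 <= \sum_(i < size c) a i by apply: sumr_ge0.
  have [rz|rz] := eqVneq (\sum_(i < size c) a i) 0.
    have az (i : 'I_(size c)) : a i = 0 by apply/(psumr_eq0P _ rz).
    left; split; last by rewrite big1 // => i _; rewrite az scale0r.
    by rewrite xE big1 // => i _; rewrite az scale0r.
  have rp : 0 < \sum_(i < size c) a i by rewrite lt_def rz.
  right; exists (\sum_(i < size c) a i).
  have [h1 h2] := affine_on_sum (faff cc) a0 (fun i => @conv_hull_mem _ _ c i) rp.
  by split=> //; rewrite xE //; apply/csE; exists c.
move=> [y [[-> ->]|[r [r0 Xx ->]]] <-].
  by exists [::]; [rewrite mem_head | rewrite linear0; apply: cone0].
have [c cc /conv_hullP[a [a0 a1 xE]]] := (csE _).1 Xx.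
have a1p : 0 < \sum_(i < size c) a i by rewrite a1 ltr01.
have [_] := affine_on_sum (faff cc) a0 (fun i => @conv_hull_mem _ _ c i) a1p.
rewrite a1 invr1 !scale1r -xE => fE.
exists [seq (z, mod_diagonal (f z)) | z <- c].
  by rewrite inE; apply/orP; right; apply: map_f.
exists (fun i => r * a i); first by move=> i; rewrite mulr_ge0 // ltW.
have xr : x = \sum_(i < size c) (r * a i) *: c`_i.
  rewrite -[x](@scale1r R E) -(mulfV (lt0r_neq0 r0)) -scalerA xE scaler_sumr.
  by apply: eq_bigr => i _; rewrite scalerA.
rewrite size_map [RHS]surjective_pairing !raddf_sum; congr pair.
  by rewrite [LHS]xr; apply: eq_bigr => i _; rewrite (nth_map 0).
rewrite -fE scaler_sumr raddf_sum; apply: eq_bigr => i _ /=.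
by rewrite (nth_map 0) //= scalerA linearZ.
Qed.

Let graph_dom x y : graph x y -> link_domain e finset.set0 A x.
Proof.
move=> [[-> _]|[r [r0 /(clique_realizationP _ r0)[]//]]].
by split=> [u _|u _|u v _ _]; rewrite ffunE ?eqxx.
Qed.

Let graph_cod x y : graph x y -> boundary_cone y.
Proof.
move=> [[_ ->]|[r [r0 /fXS]]].
  by split=> [i|]; [|exists ord0]; rewrite ffunE.
move=> + yE; have -> : f (r^-1 *: x) = r^-1 *: y.
  by rewrite yE scalerA mulVf ?gt_eqF // scale1r.
by move=> /(simplex_boundaryP _ r0)[].
Qed.

Let sum_inv (V : finType) (w : coord_space R V) r : 0 < r ->
  \sum_v (r^-1 *: w) v = 1 -> \sum_v w v = r.
Proof.
move=> r0; under eq_bigr do rewrite ffunE.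
by rewrite -mulr_sumr => h; rewrite -[r]mulr1 -h mulVKf ?gt_eqF.
Qed.

(** Points of [X] and of [S] have coordinate sum 1, so a pair of the graph has the
    same coordinate sum [r] on both sides, and [r] determines how to scale back. *)
Let graph_level x y : graph x y -> \sum_u x u = \sum_i y i /\
  (\sum_u x u = 0 -> x = 0 /\ y = 0) /\
  (\sum_u x u != 0 -> let r := \sum_u x u in
     X (r^-1 *: x) /\ f (r^-1 *: x) = r^-1 *: y).
Proof.
move=> [[-> ->]|[r [r0 Xx yE]]].
  by rewrite !big1 ?eqxx //; move=> i _; rewrite ffunE.
have fE : f (r^-1 *: x) = r^-1 *: y.
  by rewrite yE scalerA mulVf ?gt_eqF // scale1r.
have Sy := fXS Xx; rewrite fE in Sy.
have [_ /(sum_inv r0) sx _] := Xx; have [_ /(sum_inv r0) sy _] := Sy.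
by rewrite sx sy; do 2?split=> //; move/eqP: (gt_eqF r0).
Qed.

Let graph_fun x y y' : graph x y -> graph x y' -> y = y'.
Proof.
move=> /graph_level[_ [h0 h1]] /graph_level[_ [h0' h1']].
have [s0|s0] := eqVneq (\sum_u x u) 0; first by rewrite (h0 s0).2 (h0' s0).2.
have := (h1' s0).2; rewrite (h1 s0).2; apply: scalerI.
by rewrite invr_eq0.
Qed.

Let graph_inj x x' y : graph x y -> graph x' y -> x = x'.
Proof.
move=> /graph_level[sx [h0 h1]] /graph_level[sx' [h0' h1']].
rewrite sx' -sx in h0' h1'.
have [s0|s0] := eqVneq (\sum_u x u) 0; first by rewrite (h0 s0).1 (h0' s0).1.
have [Xx fx] := h1 s0; have [Xx' fx'] := h1' s0.
have : (\sum_u x u)^-1 *: x = (\sum_u x u)^-1 *: x'.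
  by rewrite -(fK Xx) fx -fx' fK.
by apply: scalerI; rewrite invr_eq0.
Qed.

(** The cones over the graphs of the affine pieces of [f] form the chart. The
    homogeneous extension of [f] is onto because [g] is defined on all of [S]. *)
Lemma clique_sphere_chart : chart (link_domain e finset.set0 A) graph_pieces.
Proof.
split.
- by move=> x z /graphP[y /graph_dom].
- move=> x Dx.
  have [sx|sx] := eqVneq (\sum_u x u) 0.
    exists 0; apply/graphP; exists 0; last exact: linear0.
    left; split=> //; apply/ffunP => u; rewrite [RHS]ffunE.
    case: Dx => pos _ _; apply: (psumr_eq0P _ sx) => // v _.
    by apply: pos; rewrite finset.inE.
  have r0 : 0 < \sum_u x u.
    rewrite lt_def sx sumr_ge0 // => u _.
    by case: Dx => pos _ _; apply: pos; rewrite finset.inE.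
  exists (mod_diagonal ((\sum_u x u) *: f ((\sum_u x u)^-1 *: x))).
  apply/graphP; eexists; last by [].
  by right; exists (\sum_u x u); split=> //; apply/clique_realizationP.
- move=> z; have [y By <-] := mod_diagonal_onto z.
  have [sy|sy] := eqVneq (\sum_i y i) 0.
    exists 0; apply/graphP; exists 0; first by left.
    congr mod_diagonal; apply/ffunP => i; rewrite [LHS]ffunE; apply/esym.
    by case: By => pos _; apply: (psumr_eq0P _ sy).
  have r0 : 0 < \sum_i y i by rewrite lt_def sy sumr_ge0 // => i _; case: By.
  have Sy : S ((\sum_i y i)^-1 *: y) by apply/simplex_boundaryP.
  exists ((\sum_i y i) *: g ((\sum_i y i)^-1 *: y)); apply/graphP; exists y => //.
  right; exists (\sum_i y i).
  rewrite scalerA mulVf // scale1r gK // scalerA mulfV // scale1r; split=> //.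
  exact: gSX.
- by move=> x z z' /graphP[y gy <-] /graphP[y' gy' <-]; rewrite (graph_fun gy gy').
- move=> x x' z /graphP[y gy <-] /graphP[y' gy' /esym].
  move=> /(mod_diagonal_inj (graph_cod gy) (graph_cod gy')) yy.
  by rewrite -yy in gy'; apply: graph_inj gy gy'.
Qed.

End CliqueComplex.

(** The starting point of the iterated derivatives, with no direction split off. *)
Lemma pl_sphere_local_sphere (R : realType) (T : finType) (e : rel T)
    (A : {set T}) (D : {set {set T}}) :
  reflexive e ->
  (forall S : {set T}, S \in D <->
    [/\ S != finset.set0, S \subset A & forall u v, u \in S -> v \in S -> e u v]) ->
  is_pl_sphere (realization R D) ->
  exists n, local_sphere e (coord_space R 'I_n) finset.set0 A.
Proof.
move=> erefl DE [n [f [g [[fXS [cs [csE faff]]] [gSX _] fK gK]]]]; exists n; split.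
  by apply/pred0P => u /=; rewrite finset.inE.
eexists; split; last by move=> v; rewrite finset.inE.
exact: (clique_sphere_chart erefl DE fXS gSX fK gK csE faff).
Qed.

Local Close Scope ring_scope.
Local Open Scope order_scope.

(** * Cell complexes and the mod 2 boundary *)

Section Covers.
Variables (d : Order.disp_t) (P : finPOrderType d).
Implicit Types (z : option P) (x y s : P) (c : pred P).

(** The option type adjoins a bottom element [None], which plays the role of the
    empty cell. *)
Definition lt_bot (z : option P) (x : P) : bool := if z is Some z' then z' < x else true.

Definition interval (z : option P) (y : P) : {set P} := [set x | lt_bot z x && (x < y)]%SET.

Definition cov (z : option P) (y : P) : bool :=
  lt_bot z y && [forall x, ~~ (lt_bot z x && (x < y))].

Lemma covP z y : reflect (lt_bot z y /\ forall x, lt_bot z x -> ~ x < y) (cov z y).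
Proof.
apply: (iffP andP) => [[zy /forallP h]|[zy h]]; split=> //.
  by move=> x zx xy; have := h x; rewrite zx xy.
by apply/forallP => x; apply/negP => /andP[zx]; apply: h.
Qed.

Lemma lt_bot_trans z x y : lt_bot z x -> x < y -> lt_bot z y.
Proof. by case: z => //= z; apply: lt_trans. Qed.

Lemma cov_exists z y : lt_bot z y -> exists2 x, cov z x & x <= y.
Proof.
have [n] := ubnP #|[set x | x < y]%SET|; elim: n y => // n IH y; rewrite ltnS => lt_y zy.
have [[x /andP[zx xy]]|h] := pselect (exists x, lt_bot z x && (x < y)).
  have [|w zw wx] := IH x _ zx; last by exists w => //; apply: le_trans wx (ltW xy).
  apply: leq_trans lt_y; apply: proper_card; apply/fintype.properP; split.
    by apply/fintype.subsetP => w; rewrite !finset.inE => /lt_trans; apply.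
  by exists x; rewrite !finset.inE // ltxx.
exists y => //; apply/covP; split=> // x zx xy; apply: h.
by exists x; rewrite zx.
Qed.

Lemma facet_exists x y : x < y -> exists2 w, cov (Some w) y & x <= w.
Proof.
have [n] := ubnP #|[set w | x < w]%SET|; elim: n x => // n IH x; rewrite ltnS => lt_x xy.
have [[w /andP[xw wy]]|h] := pselect (exists w, (x < w) && (w < y)).
  have [|w' wy' ww'] := IH w _ wy; last by exists w' => //; apply: le_trans (ltW xw) ww'.
  apply: leq_trans lt_x; apply: proper_card; apply/fintype.properP; split.
    by apply/fintype.subsetP => w'; rewrite !finset.inE => ?; apply: lt_trans xw _.
  by exists w; rewrite !finset.inE // ltxx.
exists x => //; apply/covP; split=> // w xw wy; apply: h.
by exists w; rewrite (xw : x < w).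
Qed.

(** The mod 2 boundary of a set of cells; the coefficient at [None] is the
    augmentation. *)
Definition boundary c (z : option P) : bool := \big[addb/false]_(y | c y) cov z y.

(** The combinatorial content of being a cell complex that is used below; unlike the
    topological definition, it passes easily to the quotient by a zipping. *)
Record cellular : Prop := Cellular {
  cellular_thin : forall z y s x, cov z y -> cov (Some y) s -> lt_bot z x -> x < s ->
    cov z x /\ cov (Some x) s;
  cellular_boundary2 : forall s z, boundary (fun y => cov (Some y) s) z = false;
  cellular_cycle : forall s c, (forall y, c y -> cov (Some y) s) ->
    (forall z, boundary c z = false) ->
    (forall y, ~~ c y) \/ (forall y, cov (Some y) s -> c y) }.

(** As the order complex of an interval is a sphere, it is not a point, and it is
    connected unless it has dimension 0. *)
Definition interval_spheric z y : Prop :=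
  (forall u, interval z y <> [set u]%SET) /\
  forall (B : {set P}) a b, B \subset interval z y ->
   (forall u v, u \in B -> v \in interval z y -> v \notin B -> ~~ (u >=< v)) ->
   a \in B -> b \in interval z y -> b \notin B -> interval z y = [set a; b]%SET.

(** An element that covers [z] and is covered by [y] is isolated in the interval
    from [z] to [y], so such an interval has exactly two elements: this gives
    thinness and the vanishing of the squared boundary. For the cycle condition,
    induction on the interval shows that a cycle of facets of [s] contains all or
    none of the facets above [z]: membership is constant along comparabilities,
    hence on a connected interval, and on an interval with two elements it is the
    cycle condition itself. *)
Lemma spheric_cellular : (forall z y, interval_spheric z y) -> cellular.
Proof.
move=> sph.
have in_interval z s x : lt_bot z x -> x < s -> x \in interval z s.
  by move=> zx xs; rewrite finset.inE zx.
have pair z y s : cov z y -> cov (Some y) s ->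
    exists2 b, interval z s = [set y; b]%SET & ~~ (y >=< b).
  move=> /covP[zy nzy] /covP[/= ys nys].
  have iso v : v \in interval z s -> v != y -> ~~ (y >=< v).
    rewrite finset.inE => /andP[zv vs] vy; apply/negP.
    rewrite /Order.comparable !le_eqVlt eq_sym (negbTE vy) /= => /orP[yv|].
      exact: nys yv vs.
    exact: nzy.
  have [b bI bny] : exists2 b, b \in interval z s & b != y.
    apply: contrapT => h; apply: ((sph z s).1 y); apply/setP => x; rewrite finset.in_set1.
    apply/idP/eqP => [xI|->]; last exact: in_interval.
    by apply/eqP/negPn/negP => xy; apply: h; exists x.
  exists b; last exact: iso.
  apply: ((sph z s).2 [set y]%SET) => //; rewrite ?finset.in_set1 //.
  - by rewrite finset.sub1set in_interval.
  - by move=> u v; rewrite !finset.in_set1 => /eqP-> vI; apply: iso.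
have thin z y s x : cov z y -> cov (Some y) s -> lt_bot z x -> x < s ->
    cov z x /\ cov (Some x) s.
  move=> zy ys zx xs; have [b Iyb yb] := pair _ _ _ zy ys.
  have := in_interval _ _ _ zx xs; rewrite Iyb finset.inE !finset.in_set1.
  have [->//|xy /= /eqP xb] := eqVneq x y.
  rewrite -xb in yb Iyb => {b xb}.
  split; apply/covP; split=> // w h h'.
    have := in_interval _ _ _ h (lt_trans h' xs); rewrite Iyb finset.inE !finset.in_set1.
    case/orP => /eqP e; last by rewrite e ltxx in h'.
    by rewrite e in h'; rewrite /Order.comparable (ltW h') in yb.
  have := in_interval _ _ _ (lt_bot_trans zx h) h'; rewrite Iyb finset.inE !finset.in_set1.
  case/orP => /eqP e; last by rewrite /= e ltxx in h.
  by rewrite /= e in h; rewrite /Order.comparable (ltW h) orbT in yb.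
split=> //.
  move=> s z; rewrite /boundary.
  have [[y /andP[zy ys]]|h] := pselect (exists y, cov z y && cov (Some y) s); last first.
    by rewrite big1 // => y ys; apply/negP => zy; apply: h; exists y; rewrite zy.
  have [b Iyb yb] := pair _ _ _ zy ys.
  have bI : b \in interval z s by rewrite Iyb finset.inE !finset.in_set1 eqxx orbT.
  move: (bI); rewrite finset.inE => /andP[zb bs].
  have [cb bc] := thin _ _ _ _ zy ys zb bs.
  have by' : b != y by apply: contraNneq yb => ->; rewrite comparablexx.
  rewrite (bigD1 y) //= (bigD1 b) /= ?bc // zy cb big1 // => x /andP[/andP[xs xy] xb].
  apply/negP => /covP[zx _]; have /covP[xs' _] := xs.
  have := in_interval _ _ _ zx xs'; rewrite Iyb finset.inE !finset.in_set1.
  by rewrite (negbTE xy) (negbTE xb).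
move=> s c cf dc.
suff H z : (forall y, c y -> ~~ lt_bot z y) \/
    (forall y, cov (Some y) s -> lt_bot z y -> c y).
  have [h|h] := H None; first by left=> y; apply/negP => /h.
  by right=> y ys; apply: h.
(* [B] is closed under comparability in the interval because, by induction, the
   facets above an inner element are all in [c] or all outside [c]. *)
have [n] := ubnP #|interval z s|; elim: n z => // n IH z; rewrite ltnS => lt_n.
have ltc y : c y -> y < s by move=> /cf/covP[].
pose B := [set x in interval z s | [exists y, c y && (x <= y)]]%SET.
have BP x : reflect (x \in interval z s /\ exists2 y, c y & x <= y) (x \in B).
  rewrite [x \in B]finset.in_set.
  apply: (iffP andP) => [[-> /existsP[y /andP[]]]|[-> [y cy xy]]].
    by split=> //; exists y.
  by split=> //; apply/existsP; exists y; rewrite cy.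
have sB : B \subset interval z s by apply/fintype.subsetP => x /BP[].
have [[a aB]|h] := pselect (exists a, a \in B); last first.
  left=> y cy; apply/negP => zy; apply: h; exists y; apply/BP.
  by split; [apply: in_interval => //; apply: ltc | exists y].
have [[b [bI bB]]|h] := pselect (exists b, b \in interval z s /\ b \notin B); last first.
  right=> y ys zy; have /covP[ys' nys] := ys.
  have /BP[_ [y' cy']] : y \in B.
    by apply/negPn/negP => yB; apply: h; exists y; split=> //; apply: in_interval.
  rewrite le_eqVlt => /orP[/eqP->//|yy'].
  by case: (nys y' yy' (ltc _ cy')).
have Iab : interval z s = [set a; b]%SET.
  apply: ((sph z s).2 B) => // u v /BP[uI [y cy uy]] vI vB; apply/negP.
  have uv : u != v by apply: contraNneq vB => <-; apply/BP; split=> //; exists y.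
  rewrite /Order.comparable !le_eqVlt eq_sym [v == u]eq_sym (negbTE uv) /= => /orP[|vu].
    move=> ltuv; have vs : v < s by move: vI; rewrite finset.inE => /andP[].
    have ltuy : u < y.
      rewrite lt_def uy andbT; apply/eqP => yu.
      by have /covP[_ /(_ v)] := cf y cy; rewrite yu; apply.
    have [|h|h] := IH (Some u).
    - apply: leq_trans lt_n; apply: proper_card; apply/fintype.properP; split.
        apply/fintype.subsetP => w; rewrite !finset.inE /= => /andP[uw ->].
        by move: uI; rewrite finset.inE => /andP[zu _]; rewrite (lt_bot_trans zu uw).
      by exists u => //; rewrite finset.inE /= ltxx.
    - by have := h y cy; rewrite /= ltuy.
    have [w ws vw] := facet_exists vs.
    have cw := h w ws (lt_le_trans ltuv vw).
    by apply/negP: vB; rewrite negbK; apply/BP; split=> //; exists w.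
  apply/negP: vB; rewrite negbK; apply/BP; split=> //; exists y => //.
  exact: le_trans (ltW vu) uy.
have notb y : c y -> ~~ (b <= y).
  by move=> cy; apply: contra bB => by'; apply/BP; split=> //; exists y.
have memI x : x \in interval z s -> c x -> x = a.
  rewrite Iab finset.inE !finset.in_set1 => /orP[/eqP//|/eqP-> cb].
  by have := notb b cb; rewrite lexx.
have /BP[aI [y cy ay]] := aB; move: (aI); rewrite finset.inE => /andP[za als].
have ya : y = a.
  by apply: memI => //; apply: in_interval (ltc _ cy); move: ay;
     rewrite le_eqVlt => /orP[/eqP<-//|]; apply: lt_bot_trans.
have ca : c a by rewrite -ya.
have := dc z; rewrite /boundary (bigD1 a) //= big1 => [|x /andP[cx xa]]; last first.
  apply/negP => /covP[zx _].
  by move: xa; rewrite (memI x) ?eqxx // in_interval // ltc.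
rewrite addbF => /covP[]; split=> // w zw wa.
have := in_interval _ _ _ zw (lt_trans wa als); rewrite Iab finset.inE !finset.in_set1.
move=> /orP[] /eqP e; first by rewrite e ltxx in wa.
by have := notb a ca; rewrite -e (ltW wa).
Qed.

End Covers.

Section CellComplex.
Variables (R : realType) (d : Order.disp_t) (P : finPOrderType d).
Notation cmp := (fun x y : P => x >=< y).

(** Taking the link at the elements of [L] one after the other removes what is below
    [q] and leaves the interval above [q] untouched. *)
Lemma local_sphere_interval (F : lmodType R) (q s : P) (t L : {set P}) :
  (forall x, x \in L -> x <= q) ->
  local_sphere cmp F t (L :|: interval (Some q) s)%SET ->
  exists t', local_sphere cmp F t' (interval (Some q) s).
Proof.
have [n] := ubnP #|L|; elim: n L t => // n IH L t; rewrite ltnS => lt_n Lq.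
have [->|[y yL]] := finset.set_0Vmem L; first by rewrite finset.set0U; exists t.
have yLI : y \in (L :|: interval (Some q) s)%SET by rewrite finset.in_setU yL.
have csym : symmetric cmp by move=> x x'; rewrite comparable_sym.
move=> /(local_sphere_link csym yLI).
suff -> : link cmp (L :|: interval (Some q) s)%SET y =
    (link cmp L y :|: interval (Some q) s)%SET.
  apply: IH => [|x]; last by rewrite finset.inE => /andP[/Lq].
  apply: leq_trans lt_n; apply: proper_card; apply/fintype.properP; split.
    by apply/fintype.subsetP => x; rewrite finset.inE => /andP[].
  by exists y; rewrite // finset.inE eqxx andbF.
apply/setP => x; rewrite !finset.inE /=.
case: (boolP ((q < x) && (x < s))) => [/andP[qx xs]|_]; last by rewrite !orbF.
have yx : y < x := le_lt_trans (Lq y yL) qx.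
by rewrite !orbT gt_eqF //= /Order.comparable (ltW yx).
Qed.

Lemma cell_complex_cellular : cell_complex P R -> cellular P.
Proof.
move=> hP; apply: spheric_cellular => z s.
have [n hs] : exists n, local_sphere cmp (coord_space R 'I_n) finset.set0 (interval None s).
  have -> : interval None s = [set q | q < s]%SET by apply/setP => x; rewrite !finset.inE.
  apply: pl_sphere_local_sphere (hP s) => [x|S]; first exact: comparablexx.
  rewrite finset.inE; split=> [/and3P[S0 SA /forall_inP cl]|[-> SA cl]].
    by split=> // u v uS vS; have /forall_inP := cl u uS; apply.
  rewrite SA; apply/forall_inP => u uS; apply/forall_inP => v vS; exact: cl.
have csym : symmetric cmp by move=> x x'; rewrite comparable_sym.
suff [[t ht]|h] : (exists t, local_sphere cmp (coord_space R 'I_n) t (interval z s)) \/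
    interval z s = finset.set0.
- split=> [u|B a b sB sepB]; first exact: local_sphere_not_singleton ht.
  exact: local_sphere_separated ht sB sepB.
- rewrite /interval_spheric h; split=> [u /setP/(_ u)|B a b _ _ _].
    by rewrite !finset.inE eqxx.
  by rewrite finset.inE.
case: z => [q|]; last by left; exists finset.set0.
have [qs|qs] := boolP (q < s); last first.
  right; apply/setP => x; rewrite !finset.inE /=; apply/negP => /andP[qx xs].
  by rewrite (lt_trans qx xs) in qs.
left; have qI : q \in interval None s by rewrite finset.inE.
apply: (@local_sphere_interval _ q s (q |: finset.set0)%SET [set x | x < q]%SET).
  by move=> x; rewrite finset.inE => /ltW.
suff <- : link cmp (interval None s) q = ([set x | (x < q)%O] :|: interval (Some q) s)%SET.
  by have := local_sphere_link csym qI hs.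
apply/setP => x; rewrite !finset.inE /= /Order.comparable.
rewrite !le_eqVlt [q == x]eq_sym; have [->|xq] /= := eqVneq x q.
  by rewrite ltxx andbF.
have [xq'|] := boolP (x < q); first by rewrite (lt_trans xq' qs) orbT.
by rewrite orbF andbC.
Qed.

End CellComplex.

(** * Elementary zippings as chain maps *)

Lemma addb_big_exists (I : finType) (Q F : pred I) :
  (forall i j, Q i -> Q j -> F i -> F j -> i = j) ->
  \big[addb/false]_(i | Q i) F i = [exists i, Q i && F i].
Proof.
move=> uniq; apply/idP/existsP => [|[i /andP[Qi Fi]]].
  apply: contraTP => h; rewrite big1 // => i Qi; apply/negP => Fi.
  by apply: h; exists i; rewrite Qi.
rewrite (bigD1 i) //= Fi big1 // => j /andP[Qj ji].
by apply: contraNF ji => Fj; rewrite (uniq i j).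
Qed.

Section Zippable.
Variables (d : Order.disp_t) (P : finPOrderType d) (p q r : P).
Hypothesis Zp : zippable p q r.
Implicit Types (x y s t : P).

Notation tri := [set p; q; r]%SET.

Lemma triP x : x \in tri -> [\/ x = p, x = q | x = r].
Proof.
rewrite !finset.inE => /orP[/orP[]|] /eqP; by [apply: Or31|apply: Or32|apply: Or33].
Qed.

Lemma zip_lt_q : q < p. Proof. by have [[_ _ h _] _ _ _ _] := Zp. Qed.
Lemma zip_lt_r : r < p. Proof. by have [_ [_ _ h _] _ _ _] := Zp. Qed.
Lemma zip_incomparable : ~~ (q >=< r). Proof. by have [_ _ h _ _] := Zp. Qed.

Lemma zip_cov_q : cov (Some q) p.
Proof.
have [[_ _ _ h] _ _ _ _] := Zp.
apply/covP; split=> [|x qx xp]; first exact: zip_lt_q.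
by apply: (h x).
Qed.

Lemma zip_cov_r : cov (Some r) p.
Proof.
have [_ [_ _ _ h] _ _ _] := Zp.
apply/covP; split=> [|x qx xp]; first exact: zip_lt_r.
by apply: (h x).
Qed.

Lemma zip_neq : [/\ q != p, r != p & q != r].
Proof.
rewrite (lt_eqF zip_lt_q) (lt_eqF zip_lt_r); split=> //.
by apply: contraNneq zip_incomparable => ->; rewrite comparablexx.
Qed.

Lemma below_p s : s < p -> s != q -> s != r -> s < q /\ s < r.
Proof. by have [_ _ _ h _] := Zp; apply: h. Qed.

Lemma above_qr s : q < s -> r < s -> p <= s.
Proof. by have [_ _ _ _ h] := Zp; apply: h. Qed.

Lemma p_tri : p \in tri. Proof. by rewrite !finset.inE eqxx. Qed.
Lemma q_tri : q \in tri. Proof. by rewrite !finset.inE eqxx orbT. Qed.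
Lemma r_tri : r \in tri. Proof. by rewrite !finset.inE eqxx !orbT. Qed.

Lemma tri_le_p x : x \in tri -> x <= p.
Proof. by move=> /triP[]->; rewrite ?lexx ?(ltW zip_lt_q) ?(ltW zip_lt_r). Qed.

Lemma tri_lt x y : x \in tri -> y \in tri -> x < y -> y = p.
Proof.
have cqr : (q < r) = false.
  by apply: contraNF zip_incomparable => h; rewrite /Order.comparable ltW.
have crq : (r < q) = false.
  by apply: contraNF zip_incomparable => h; rewrite /Order.comparable (ltW h) orbT.
move=> /triP hx /triP[-> //| ->| ->]; case: hx => ->; rewrite ?ltxx ?cqr ?crq //.
  by rewrite (lt_gtF zip_lt_q).
by rewrite (lt_gtF zip_lt_r).
Qed.

Lemma facets_p z : cov z p -> z = Some q \/ z = Some r.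
Proof.
case: z => [z|] /covP[/= zp nz]; last by case: (nz q isT zip_lt_q).
have [->|zq] := eqVneq z q; first by left.
have [->|zr] := eqVneq z r; first by right.
by have [zq' _] := below_p zp zq zr; case: (nz q zq' zip_lt_q).
Qed.

End Zippable.

(** [P1] is the quotient of [P] by the triple, presented by its projection; this
    form covers both the given quotients and the one that is constructed. *)
Record zip_map (d d1 : Order.disp_t) (P : finPOrderType d) (P1 : finPOrderType d1)
    (p q r : P) (pi : P -> P1) : Prop := ZipMap {
  zip_zippable : zippable p q r;
  zip_onto : forall y, exists x, pi x = y;
  zip_eq : forall x y, pi x = pi y <->
    x = y \/ x \in [set p; q; r]%SET /\ y \in [set p; q; r]%SET;
  zip_le : forall x y, pi x <= pi y <->
    exists x' y', [/\ pi x' = pi x, pi y' = pi y & x' <= y'] }.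

Section Zip.
Variables (d d1 : Order.disp_t) (P : finPOrderType d) (P1 : finPOrderType d1).
Variables (p q r : P) (pi : P -> P1).
Hypothesis Z : zip_map p q r pi.
Implicit Types (x y s t : P).

Notation tri := [set p; q; r]%SET.

Let zpqr : zippable p q r := zip_zippable Z.
Let p_tri := p_tri p q r.
Let q_tri := q_tri p q r.
Let r_tri := r_tri p q r.
Let qp := zip_lt_q zpqr.
Let rp := zip_lt_r zpqr.

Lemma tri_pi x y : x \in tri -> y \in tri -> pi x = pi y.
Proof. by move=> hx hy; apply/(zip_eq Z); right. Qed.

Lemma pi_le x y : x <= y -> pi x <= pi y.
Proof. by move=> xy; apply/(zip_le Z); exists x, y. Qed.

Lemma pi_lt x y : x < y -> y != p -> pi x < pi y.
Proof.
move=> xy yp; rewrite lt_def pi_le ?ltW // andbT; apply/eqP => /(zip_eq Z)[e|[ty tx]].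
  by rewrite e ltxx in xy.
by rewrite (tri_lt zpqr tx ty xy) eqxx in yp.
Qed.

Lemma pi_rep (x' : P1) : exists2 x, x != p & pi x = x'.
Proof.
have [x <-] := zip_onto Z x'; have [->|xp] := eqVneq x p; last by exists x.
exists q; last exact: tri_pi q_tri p_tri.
by have [] := (zip_neq zpqr).
Qed.

(** The order of the quotient, transported to [P]; the representative can be chosen
    below [t] itself since an element outside the triple that is below one of its
    members is below all of them. *)
Lemma lift_below t (x' : P1) : t != p -> x' < pi t ->
  exists x, [/\ x != p, pi x = x' & x < t].
Proof.
have [qnp rnp _] := (zip_neq zpqr).
have [x0 <-] := zip_onto Z x'; move=> tp lt_x0t.
have [x1 [t1 [ex et le1]]] := (zip_le Z _ _).1 (ltW lt_x0t).
have lt1 : x1 < t1.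
  rewrite lt_def le1 andbT; apply/eqP => e.
  by move: lt_x0t; rewrite -ex -et e ltxx.
have [e|[t1t tt]] := (zip_eq Z _ _).1 et.
  rewrite e in lt1; have [x1p|x1p] := eqVneq x1 p; last by exists x1.
  exists q; split=> //; last by apply: lt_trans qp _; rewrite -x1p.
  by rewrite -ex x1p; apply: tri_pi q_tri p_tri.
have nx1 : x1 \notin tri.
  by apply/negP => x1t; move: lt_x0t; rewrite -ex (tri_pi x1t tt) ltxx.
have x1p : x1 < p := lt_le_trans lt1 (tri_le_p zpqr t1t).
have [x1q x1r] : x1 < q /\ x1 < r.
  by apply: (below_p zpqr) => //; apply: contraNneq nx1 => ->; [exact: q_tri | exact: r_tri].
exists x1; split=> //; first by rewrite lt_eqF.
by case/triP: tt tp => -> //; rewrite eqxx.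
Qed.

Hypothesis cP : cellular P.

(** As the boundary squares to zero, a cell [z] of codimension 2 lies in an even
    number of facets of [t], so besides [p] there is another one. *)
Lemma other_cover (z : P) t : cov (Some z) p -> cov (Some p) t ->
  exists y, [/\ y != p, z < y & y < t].
Proof.
move=> zp pt; apply: contrapT => h.
have := cellular_boundary2 cP t (Some z); rewrite /boundary (bigD1 p) //= zp big1 //.
move=> y /andP[/covP[yt _] yp]; apply/negP => /covP[zy _].
by apply: h; exists y.
Qed.

Lemma cov_pi z t : z != Some p -> t != p -> cov z t -> cov (omap pi z) (pi t).
Proof.
move=> zp tp /covP[zt nzt]; apply/covP; split.
  by case: z zp zt {nzt} => //= z _ zt; apply: pi_lt.
move=> x' zx' /(lift_below tp)[x [xp ex xt]].
case: z zp zt nzt zx' => [z|] zp /= zt nzt zx'; last exact: (nzt x).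
have {}zp : z != p by apply: contraNneq zp => ->.
rewrite -ex in zx'; have [z1 [z1p ez1 z1x]] := lift_below xp zx'.
have [z1z|[tz1 tz]] := (zip_eq Z _ _).1 ez1; first by apply: (nzt x); rewrite -?z1z.
have z1t := lt_trans z1x xt.
have lepz : p <= t.
  case/triP: tz zp zt nzt => -> zp zt nzt; first by rewrite eqxx in zp.
    case/triP: tz1 z1p z1x z1t => -> z1p z1x z1t; first by rewrite eqxx in z1p.
      by case: (nzt x).
    exact: (above_qr zpqr).
  case/triP: tz1 z1p z1x z1t => -> z1p z1x z1t; first by rewrite eqxx in z1p.
    exact: (above_qr zpqr).
  by case: (nzt x).
apply: (nzt p); last by rewrite lt_def tp.
by have := tri_le_p zpqr tz; rewrite le_eqVlt (negbTE zp).
Qed.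

(** If [z] and [p] are below [t] with [z] one of [q], [r], then the image of [z] is
    not covered by that of [t]: when [t] covers [p], the facet of [t] on the other
    side of [z] is strictly in between. *)
Lemma cov_pi_lift (z' : option P1) t : t != p -> cov z' (pi t) ->
  exists z, [/\ z != Some p, omap pi z = z' & cov z t].
Proof.
have [qnp rnp _] := (zip_neq zpqr).
move=> tp; case: z' => [z'|] /covP[/= zt nzt]; last first.
  exists None; split=> //; apply/covP; split=> //= x _ xt.
  by apply: (nzt (pi x)) => //; apply: pi_lt.
have [z [zp ez lt_zt]] := lift_below tp zt.
exists (Some z); split=> //=; first by rewrite ez.
apply/covP; split=> //= x zx xt.
have [[tz tx]|h] := pselect (z \in tri /\ x \in tri); last first.
  apply: (nzt (pi x)); last exact: pi_lt.
  rewrite -ez lt_def pi_le ?ltW // andbT; apply/eqP => /(zip_eq Z)[e|[tx tz]].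
    by rewrite e ltxx in zx.
  by apply: h.
have xp := tri_lt zpqr tz tx zx; rewrite xp in zx xt.
have zq : pi q = z' by rewrite -ez; apply: tri_pi => //; apply: q_tri.
have [pt|npt] := boolP (cov (Some p) t).
  have [y [yp qy yt]] := other_cover (zip_cov_q zpqr) pt.
  by apply: (nzt (pi y)); [rewrite -zq pi_lt | apply: pi_lt].
have [w pw wt] : exists2 w, p < w & w < t.
  apply: contrapT => h; move/negP: npt; apply; apply/covP; split=> // w pw wt.
  by apply: h; exists w.
apply: (nzt (pi w)); last exact: pi_lt.
by rewrite -zq pi_lt ?(lt_trans qp) // gt_eqF.
Qed.

Lemma cov_pi_inj z z' t : z != Some p -> z' != Some p -> t != p ->
  cov z t -> cov z' t -> omap pi z = omap pi z' -> z = z'.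
Proof.
case: z z' => [z|] [z'|] //= zp zp' tp /covP[/= zt nzt] /covP[/= zt' nzt'] [].
move=> /(zip_eq Z)[->//|[tz tz']].
have h : q < t -> r < t -> p < t by move=> qt rt; rewrite lt_def tp (above_qr zpqr).
case/triP: tz zp zt nzt => ->; first by rewrite eqxx.
  case/triP: tz' zp' zt' nzt' => ->; rewrite ?eqxx // => _ rt nrt _ qt _.
  by case: (nrt p rp); apply: h.
case/triP: tz' zp' zt' nzt' => ->; rewrite ?eqxx // => _ qt nqt _ rt _.
by case: (nqt p qp); apply: h.
Qed.

(** Modulo 2, [pi] commutes with the boundary if [p] is sent to zero; that the
    boundary of [p], which is [q + r], is then also sent to zero is [cov_p_sum]. *)
Lemma cov_pi_sum (z' : option P1) t : t != p ->
  cov z' (pi t) = \big[addb/false]_(z | (z != Some p) && (omap pi z == z')) cov z t.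
Proof.
move=> tp; rewrite addb_big_exists; last first.
  move=> z z2 /andP[zp /eqP e] /andP[zp2 /eqP e2] zt zt2.
  by apply: cov_pi_inj zp zp2 tp zt zt2 _; rewrite e.
apply/idP/existsP => [/(cov_pi_lift tp)[z [zp e zt]]|[z /andP[/andP[zp /eqP<-]]]].
  by exists z; rewrite zp e eqxx.
exact: cov_pi.
Qed.

Lemma cov_p_sum (z' : option P1) :
  \big[addb/false]_(z | (z != Some p) && (omap pi z == z')) cov z p = false.
Proof.
have [qnp rnp qnr] := (zip_neq zpqr).
have [e|ne] := eqVneq (Some (pi q)) z'; last first.
  rewrite big1 // => z /andP[_ /eqP e]; apply/negP => /(facets_p zpqr)[] ez; rewrite ez in e.
    by rewrite -e eqxx in ne.
  by rewrite -e /= (tri_pi q_tri r_tri) eqxx in ne.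
rewrite (bigD1 (Some q)) /=; last by rewrite e eqxx andbT (inj_eq Some_inj).
rewrite (bigD1 (Some r)) /=; last first.
  by rewrite -(tri_pi q_tri r_tri) e eqxx andbT !(inj_eq Some_inj) rnp eq_sym.
rewrite (zip_cov_q zpqr) (zip_cov_r zpqr) big1 // => z /andP[/andP[_ zq] zr].
by apply/negP => /(facets_p zpqr)[] ez; rewrite ez eqxx in zq zr.
Qed.

Lemma sum_pi (c : pred P) (c' : pred P1) (F : P1 -> bool) :
  (forall x y, c x -> c y -> pi x = pi y -> x = y) ->
  (forall y' : P1, c' y' <-> exists2 y, c y & pi y = y') ->
  \big[addb/false]_(y' | c' y') F y' = \big[addb/false]_(y | c y) F (pi y).
Proof.
move=> inj cE; rewrite (partition_big pi c') => [|y cy]; last by apply/cE; exists y.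
apply: eq_bigr => y' /cE[y cy <-]; rewrite (bigD1 y) /= ?cy ?eqxx // big1 ?addbF //.
by move=> x /andP[/andP[cx /eqP e]]; rewrite (inj x y) ?eqxx.
Qed.

(** The chain map on sets of facets of one cell, where [pi] is injective. *)
Lemma boundary_pi s (c : pred P) (c' : pred P1) (z' : option P1) : s != p ->
  (forall y, c y -> y != p /\ cov (Some y) s) ->
  (forall y' : P1, c' y' <-> exists2 y, c y & pi y = y') ->
  boundary c' z' =
    \big[addb/false]_(z | (z != Some p) && (omap pi z == z')) boundary c z.
Proof.
move=> sp cs cE; rewrite /boundary (sum_pi _ _ cE) => [|x y /cs[xp xs] /cs[yp ys] e].
  rewrite (eq_bigr (fun y => \big[addb/false]_(z | (z != Some p) && (omap pi z == z'))
    cov z y)) => [|y /cs[yp _]]; last exact: cov_pi_sum.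
  exact: exchange_big.
have nSp w : w != p -> Some w != Some p by rewrite (inj_eq Some_inj).
have := cov_pi_inj (nSp x xp) (nSp y yp) sp xs ys; rewrite /= e.
by move=> /(_ erefl)[].
Qed.

Lemma facets_pi s (y' : P1) : s != p ->
  cov (Some y') (pi s) <-> exists2 y, (y != p) && cov (Some y) s & pi y = y'.
Proof.
move=> sp; split=> [/(cov_pi_lift sp)[[y|] [yp //= [<-] ys]]|[y /andP[yp ys] <-]].
  by exists y => //; rewrite ys andbT -(inj_eq Some_inj).
by apply: (cov_pi (z := Some y)) => //; rewrite (inj_eq Some_inj).
Qed.

(** The squared boundary of the image of [s] is the image of the squared boundary of
    [s]. *)
Lemma zip_cellular_boundary2 (s' : P1) (z' : option P1) :
  boundary (fun y : P1 => cov (Some y) s') z' = false.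
Proof.
have [s sp <-] := pi_rep s'.
rewrite (@boundary_pi s (fun y => (y != p) && cov (Some y) s)) //; first last.
- by move=> y'; apply: facets_pi.
- by move=> y /andP.
have [ps|nps] := boolP (cov (Some p) s).
  rewrite -[RHS](cov_p_sum z'); apply: eq_bigr => z _.
  have := cellular_boundary2 cP s z; rewrite /boundary (bigD1 p) //=.
  rewrite (eq_bigl (fun y => (y != p) && cov (Some y) s)) => [|y]; last exact: andbC.
  by move: (\big[addb/false]_(y | (y != p) && cov (Some y) s) cov z y); case: cov => -[].
rewrite big1 // => z _; rewrite -[RHS](cellular_boundary2 cP s z).
apply: eq_bigl => y; have [->|//] := eqVneq y p.
by rewrite (negbTE nps).
Qed.

Lemma zip_cellular_thin (z' : option P1) (y' s' x' : P1) :
  cov z' y' -> cov (Some y') s' -> lt_bot z' x' -> x' < s' ->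
  cov z' x' /\ cov (Some x') s'.
Proof.
have [s sp <-] := pi_rep s' => zy' /(facets_pi _ sp)[y /andP[yp ys] ey].
move: zy'; rewrite -ey => /(cov_pi_lift yp)[z [zp <- zy]] zx' /(lift_below sp)[x [xp ex xs]].
rewrite -ex in zx' *; have xp' : Some x != Some p by rewrite (inj_eq Some_inj).
suff [w [wp <- wx xs']] : exists w, [/\ w != Some p, omap pi w = omap pi z, cov w x &
    cov (Some x) s].
  by split; [apply: cov_pi | apply: (cov_pi (z := Some x))].
case: z zp zy zx' => [z|] zp zy /= zx'; last first.
  by exists None; split=> //; have [] := cellular_thin cP zy ys _ xs.
have [w [wp ew wx]] := lift_below xp zx'.
suff [wx' xs'] : cov (Some w) x /\ cov (Some x) s.
  by exists (Some w); rewrite /= ew (inj_eq Some_inj) wp.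
have thin0 : lt_bot (Some z) x -> cov (Some z) x /\ cov (Some x) s.
  by move=> zx; apply: (cellular_thin cP zy ys zx xs).
have [e|[tw tz]] := (zip_eq Z _ _).1 ew; first by rewrite -e in thin0; apply: thin0.
rewrite (inj_eq Some_inj) in zp.
have covp v : v \in tri -> v != p -> cov (Some v) p.
  by case/triP => ->; rewrite ?eqxx // => _; [apply: (zip_cov_q zpqr) | apply: (zip_cov_r zpqr)].
have [e|wz] := eqVneq w z; first by rewrite -e in thin0; apply: thin0.
have zs : z < s by have /covP[zy' _] := zy; have /covP[ys' _] := ys; apply: lt_trans ys'.
have ws := lt_trans wx xs.
have lt_ps : p < s.
  rewrite lt_def sp /=; case/triP: tw wp wz ws => -> //; rewrite ?eqxx // => _.
    case/triP: tz zp zs => -> //; rewrite ?eqxx // => *; exact: (above_qr zpqr).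
  case/triP: tz zp zs => -> //; rewrite ?eqxx // => *; exact: (above_qr zpqr).
have /covP[zp' _] := covp z tz zp.
have [_ ps] := cellular_thin cP zy ys zp' lt_ps.
exact: (cellular_thin cP (covp w tw wp) ps wx xs).
Qed.

Section Cycle.
Variables (s : P) (c' : pred P1).
Hypothesis sp : s != p.
Hypothesis c's : forall y' : P1, c' y' -> cov (Some y') (pi s).
Hypothesis dc' : forall z' : option P1, boundary c' z' = false.

Let c : pred P := fun y => [&& y != p, cov (Some y) s & c' (pi y)].

Let cE (y' : P1) : c' y' <-> exists2 y, c y & pi y = y'.
Proof.
split=> [cy'|[y /and3P[_ _ cy] <-] //].
have [y /andP[yp ys] e] := (facets_pi _ sp).1 (c's cy').
by exists y; rewrite // /c yp ys e.
Qed.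

Let sum_fibre (z' : option P1) :
  \big[addb/false]_(z | (z != Some p) && (omap pi z == z')) boundary c z = false.
Proof.
rewrite -[RHS](dc' z'); apply/esym.
by apply: (@boundary_pi s c c' z' sp) => [y /and3P[]|y'] //; apply: cE.
Qed.

Let boundary_out z : (forall z0, z = Some z0 -> z0 \notin tri) -> boundary c z = false.
Proof.
move=> nz; rewrite -[RHS](sum_fibre (omap pi z)) (big_pred1 z) // => z2 /=.
apply/andP/eqP => [[_ /eqP]|->]; last first.
  split=> //; apply/eqP => e; have := nz p e.
  by rewrite p_tri.
case: z z2 nz => [z|] [z2|] //= nz [] /(zip_eq Z)[->//|[_ tz]].
by have := nz z erefl; rewrite tz.
Qed.

Let boundary_qr : boundary c (Some q) = boundary c (Some r).
Proof.
have [qnp rnp qnr] := (zip_neq zpqr).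
have := sum_fibre (Some (pi q)).
rewrite (bigD1 (Some q)) /=; last by rewrite eqxx andbT (inj_eq Some_inj).
rewrite (bigD1 (Some r)) /=; last first.
  by rewrite -(tri_pi q_tri r_tri) eqxx andbT !(inj_eq Some_inj) rnp eq_sym.
rewrite big1; last first.
  move=> [z|] // /andP[/andP[/andP[zp _] zq] zr]; apply: boundary_out => _ [<-].
  rewrite !(inj_eq Some_inj) in zp zq zr.
  by rewrite !finset.inE (negbTE zp) (negbTE zq) (negbTE zr).
by case: boundary; case: boundary.
Qed.

Let boundary_p : boundary c (Some p) = false.
Proof.
have [qnp rnp qnr] := (zip_neq zpqr).
have h : \big[addb/false]_w (cov (Some q) w && boundary c (Some w)) = false.
  transitivity (\big[addb/false]_(y | c y) \big[addb/false]_w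
      (cov (Some q) w && cov (Some w) y)).
    by rewrite exchange_big; apply: eq_bigr => w _; rewrite big_distrr.
  rewrite big1 // => y _; rewrite -[RHS](cellular_boundary2 cP y (Some q)).
  by rewrite [RHS]big_mkcond; apply: eq_bigr => w _; rewrite andbC; case: ifP.
move: h; rewrite (bigD1 p) //= (zip_cov_q zpqr) big1 ?addbF // => w wp.
have [wt|wt] := boolP (w \in tri); last by rewrite boundary_out ?andbF // => _ [<-].
suff -> : cov (Some q) w = false by [].
apply/negP => /covP[/= qw _]; have e := tri_lt zpqr q_tri wt qw.
by rewrite e eqxx in wp.
Qed.

(** A cycle of facets in the quotient lifts to a set of facets of [s] whose boundary
    is killed by [pi], hence is a combination of [p] and [q + r]; since the boundary
    of a boundary vanishes, [p] does not occur. *)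
Lemma zip_cycle :
  (forall y' : P1, ~~ c' y') \/ (forall y' : P1, cov (Some y') (pi s) -> c' y').
Proof.
have [qnp rnp qnr] := (zip_neq zpqr).
have c_s y : c y -> cov (Some y) s by move=> /and3P[].
suff [h|h] : (forall y, ~~ c y) \/ (forall y, cov (Some y) s -> y != p -> c y).
- by left=> y'; apply/negP => /cE[y cy _]; have := h y; rewrite cy.
- right=> y' /(facets_pi _ sp)[y /andP[yp ys] <-].
  by have /and3P[] := h y ys yp.
(* The boundary of the lifted chain [c] is zero or [q + r]; in the second case
   adding [p] to [c] yields a cycle. *)
have [bq|bq] := boolP (boundary c (Some q)); last first.
  have [z|h|h] := cellular_cycle cP c_s; [|by left|by right=> y ys _; apply: h].
  have [[z0 [-> tz]]|nz] := pselect (exists z0, z = Some z0 /\ z0 \in tri); last first.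
    by apply: boundary_out => z0 e; apply/negP => tz; apply: nz; exists z0.
  by case/triP: tz => ->; rewrite ?boundary_p -?boundary_qr ?(negbTE bq).
have ex v : boundary c (Some v) -> exists2 y, c y & cov (Some v) y.
  move=> bv; apply: contrapT => h; move: bv; rewrite /boundary big1 // => y cy.
  by apply/negP => vy; apply: h; exists y.
have [y cy qy] := ex q bq; have [y2 cy2 ry2] := ex r (etrans (esym boundary_qr) bq).
have below (v w : P) : cov (Some v) w -> v < w by move=> /covP[].
have ps : cov (Some p) s.
  have lt_ps : p < s.
    rewrite lt_def sp /=; apply: (above_qr zpqr).
      exact: (lt_trans (below _ _ qy) (below _ _ (c_s _ cy))).
    exact: (lt_trans (below _ _ ry2) (below _ _ (c_s _ cy2))).
  by have [] := cellular_thin cP qy (c_s _ cy) (qp : lt_bot (Some q) p) lt_ps.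
have [x|z|h|h] := cellular_cycle cP (s := s) (c := [pred y | c y || (y == p)]).
- by case/orP => [/c_s|/eqP->].
- have cp : ~~ c p by rewrite /c eqxx.
  rewrite /boundary (bigD1 p) /= ?eqxx ?orbT //.
  have -> : \big[addb/false]_(i | (c i || (i == p)) && (i != p)) cov z i = boundary c z.
    apply: eq_bigl => x; have [->|_] := eqVneq x p; rewrite ?andbT ?orbF //.
    by rewrite andbF (negbTE cp).
  have [[z0 [-> tz]]|nz] := pselect (exists z0, z = Some z0 /\ z0 \in tri); last first.
    rewrite boundary_out; last by move=> z0 e; apply/negP => tz; apply: nz; exists z0.
    rewrite addbF; apply/negP => /(facets_p zpqr)[] e; apply: nz.
      by exists q; rewrite q_tri.
    by exists r; rewrite r_tri.
  case/triP: tz => ->; last 2 first.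
  + by rewrite bq (zip_cov_q zpqr).
  + by rewrite -boundary_qr bq (zip_cov_r zpqr).
  by rewrite boundary_p addbF; apply/negP => /covP[]; rewrite /= ltxx.
- by have := h p; rewrite /= eqxx orbT.
- right=> x xs xp; have := h x xs; rewrite /= (negbTE xp) orbF; apply.
Qed.
End Cycle.

Lemma zip_cellular : cellular P1.
Proof.
split; first exact: zip_cellular_thin.
  exact: zip_cellular_boundary2.
move=> s' c'; have [s sp <-] := pi_rep s'; exact: zip_cycle.
Qed.
End Zip.

(** * Constructibility of the dual along a zipping *)

Section Coconstructible.
Variables (d : Order.disp_t) (P : finPOrderType d).
Implicit Types (x y : P) (A Q S U : {set P}).

Definition upset U : Prop := forall x y, x \in U -> x <= y -> y \in U.

Definition minimal_in U y : Prop := y \in U /\ forall x, x \in U -> ~ x < y.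

(** The condition on the minimal elements of an intersection, where only one of the
    two parts is considered. *)
Definition covering U V : Prop :=
  forall x, minimal_in U x -> exists2 y, minimal_in V y & cov (Some y) x.

(** Constructibility of the dual, in terms of the order of [P] itself. The covering
    relation of [P] can be used since all sets are upward closed. *)
Inductive coconstructible : {set P} -> Prop :=
| coconstructible_bot A p :
    p \in A -> (forall q, q \in A -> p <= q) -> coconstructible A
| coconstructible_union Q S :
    upset Q -> upset S ->
    coconstructible Q -> coconstructible S -> coconstructible (Q :&: S)%SET ->
    covering (Q :&: S)%SET Q -> covering (Q :&: S)%SET S ->
    coconstructible (Q :|: S)%SET.

Lemma upsetI Q S : upset Q -> upset S -> upset (Q :&: S)%SET.
Proof.
move=> uQ uS x y; rewrite !finset.in_setI => /andP[xQ xS] xy.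
by rewrite (uQ x) // (uS x).
Qed.

Lemma minimal_exists U x : x \in U -> exists2 m, minimal_in U m & m <= x.
Proof.
have [n] := ubnP #|[set y | y < x]%SET|; elim: n x => // n IH x; rewrite ltnS => lt_n xU.
have [[y [yU yx]]|h] := pselect (exists y, y \in U /\ y < x).
  have [|m mU my] := IH y _ yU; last by exists m => //; apply: le_trans my (ltW yx).
  apply: leq_trans lt_n; apply: proper_card; apply/fintype.properP; split.
    by apply/fintype.subsetP => w; rewrite !finset.inE => /lt_trans; apply.
  by exists y; rewrite !finset.inE // ltxx.
by exists x => //; split=> // y yU yx; apply: h; exists y.
Qed.

(** An element of [S] below a minimal element [x] of [Q] would make [x] minimal in
    the intersection, where it covers an element of [Q]. *)
Lemma minimal_unionl Q S x : upset S -> covering (Q :&: S)%SET Q ->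
  minimal_in Q x -> minimal_in (Q :|: S)%SET x.
Proof.
move=> uS cvQ [xQ mx]; split=> [|y]; first by rewrite finset.in_setU xQ.
rewrite finset.in_setU => /orP[/mx//|yS] yx.
have [|z [zQ _] /covP[zx _]] := cvQ x; last exact: (mx z).
split; first by rewrite finset.in_setI xQ (uS y) ?ltW.
by move=> w; rewrite finset.in_setI => /andP[/mx].
Qed.

Lemma minimal_unionr Q S x : upset Q -> covering (Q :&: S)%SET S ->
  minimal_in S x -> minimal_in (Q :|: S)%SET x.
Proof. by rewrite finset.setIC finset.setUC; apply: minimal_unionl. Qed.

Lemma constructible_coconstructible (A : {set P^d}) :
  constructible A -> @upset A -> @coconstructible A.
Proof.
elim=> {A} [A p pA pmax uA|A Q S -> iQ iS _ IHQ _ IHS _ IHI cv uA].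
  exact: (@coconstructible_bot A p).
have uQ : @upset Q.
  move=> x y xQ xy; case: iQ => _ h.
  apply: (h y x) => //.
  by apply: (uA x y) => //; rewrite finset.in_setU xQ.
have uS : @upset S.
  move=> x y xS xy; case: iS => _ h.
  apply: (h y x) => //.
  by apply: (uA x y) => //; rewrite finset.in_setU xS orbT.
have covE x y : @covers_in _ P^d (Q :|: S)%SET y x -> cov (Some y) x.
  move=> [yA xA yx h]; apply/covP; split=> // w yw wx.
  by apply: (h w); [apply: (uA y w) => //; apply: ltW yw | split].
apply: coconstructible_union => //; [exact: IHQ | exact: IHS | apply: IHI | |].
- exact: upsetI.
- by move=> x /cv[[y my cy] _]; exists y => //; apply: covE.
- by move=> x /cv[_ [y my cy]]; exists y => //; apply: covE.
Qed.

Lemma coconstructible_constructible A :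
  coconstructible A -> upset A -> @constructible _ P^d A.
Proof.
elim=> {A} [A p pA pmax uA|Q S uQ uS _ IHQ _ IHS _ IHI cvQ cvS uA].
  exact: (@constructible_top _ P^d A p).
have covE x y : x \in (Q :|: S)%SET -> y \in (Q :|: S)%SET -> cov (Some y) x ->
    @covers_in _ P^d (Q :|: S)%SET y x.
  by move=> xA yA /covP[yx h]; split=> // w _ [wy xw]; apply: (h w).
apply: (@constructible_union _ P^d _ Q S) => //.
- split; first exact: finset.subsetUl.
  by move=> x y _ yQ xy; apply: (uQ y).
- split; first exact: finset.subsetUr.
  by move=> x y _ yS xy; apply: (uS y).
- exact: IHQ.
- exact: IHS.
- by apply: IHI; apply: upsetI.
- move=> x mx; have [xQS _] := mx.
  have xA : x \in (Q :|: S)%SET.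
    by move: xQS; rewrite finset.in_setI finset.in_setU => /andP[->].
  have [y my cy] := cvQ x mx; have [z mz cz] := cvS x mx.
  split; [exists y | exists z] => //; apply: covE => //.
    by case: my => yQ _; rewrite finset.in_setU yQ.
  by case: mz => zS _; rewrite finset.in_setU zS orbT.
Qed.

End Coconstructible.

Section ZipCoconstructible.
Variables (d d1 : Order.disp_t) (P : finPOrderType d) (P1 : finPOrderType d1).
Variables (p q r : P) (pi : P -> P1).
Hypothesis Z : zip_map p q r pi.
Hypothesis cP : cellular P.
Implicit Types (x y : P) (Q S U V : {set P}).

Notation tri := [set p; q; r]%SET.
Let zpqr := zip_zippable Z.

Section Preimage.
Let preE (U' : {set P1}) x : (x \in pi @^-1: U')%SET = (pi x \in U').
Proof. by rewrite finset.inE. Qed.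

Lemma upset_preimage (U' : {set P1}) : upset U' -> upset (pi @^-1: U')%SET.
Proof. by move=> uU x y; rewrite !preE => xU xy; apply: uU xU _; apply: (pi_le Z). Qed.

Lemma minimal_preimage_neq (U' : {set P1}) x : minimal_in (pi @^-1: U')%SET x -> x != p.
Proof.
move=> [xU mx]; apply: contraPneq xU => xp xU.
apply: (mx q); last by rewrite xp (zip_lt_q zpqr).
by rewrite preE (tri_pi Z (q_tri p q r) (p_tri p q r)) -xp -preE.
Qed.

Lemma covering_preimage (U' V' : {set P1}) : covering U' V' ->
  covering (pi @^-1: U')%SET (pi @^-1: V')%SET.
Proof.
move=> cv x mx; have xp := minimal_preimage_neq mx; have [xU nx] := mx.
have [|y' [y'V ny'] y'x] := cv (pi x).
  split=> [|w' w'U /(lift_below Z xp)[w [_ ew wx]]]; first by rewrite -preE.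
  by apply: (nx w) => //; rewrite preE ew.
have [z [+ + +]] := cov_pi_lift Z cP xp y'x; case: z => [y|] //= yp [ey] yx.
exists y => //; split=> [|w]; first by rewrite preE ey.
rewrite preE => wV wy; apply: (ny' _ wV); rewrite -ey.
by apply: (pi_lt Z wy); rewrite -(inj_eq Some_inj).
Qed.

(** The preimage of a cone is a cone, except over the identified cell, where it is
    the union of the cones over [q] and [r]; these meet in the cone over [p], and
    [p] covers [q] and [r]. *)
Lemma coconstructible_preimage (U' : {set P1}) : coconstructible U' -> upset U' ->
  coconstructible (pi @^-1: U')%SET.
Proof.
have [qnp rnp qnr] := zip_neq zpqr.
elim=> {U'} [U' p' p'U p'min|Q' S' uQ uS _ IHQ _ IHS _ IHI cvQ cvS] uU; last first.
  rewrite finset.preimsetU; apply: coconstructible_union; rewrite -?finset.preimsetI.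
  - exact: upset_preimage.
  - exact: upset_preimage.
  - exact: IHQ.
  - exact: IHS.
  - by apply: IHI; apply: upsetI.
  - exact: covering_preimage.
  - exact: covering_preimage.
have [x xp ex] := pi_rep Z p'.
have below y : y \in (pi @^-1: U')%SET ->
    exists x1 y1, [/\ pi x1 = pi x, pi y1 = pi y & x1 <= y1].
  by rewrite preE => /p'min; rewrite -ex => /(zip_le Z).
have [xt|xt] := boolP (x \in tri); last first.
  apply: (@coconstructible_bot _ _ _ x); first by rewrite preE ex.
  move=> y /below[x1 [y1 [/(zip_eq Z) e1 /(zip_eq Z) e2 xy1]]].
  have ex1 : x1 = x by case: e1 => [//|[_ xt']]; rewrite xt' in xt.
  rewrite ex1 in xy1; case: e2 => [<-//|[y1t yt]].
  have xlt : x < p by rewrite lt_def eq_sym xp (le_trans xy1) ?(tri_le_p zpqr).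
  have [xq xr] : x < q /\ x < r.
    by apply: (below_p zpqr xlt); apply: contraNneq xt => ->; [apply: q_tri|apply: r_tri].
  by case/triP: yt => ->; apply: ltW.
have piU v : v \in tri -> v \in (pi @^-1: U')%SET.
  by move=> vt; rewrite preE (tri_pi Z vt xt) ex.
have uA := upset_preimage uU.
(* The remaining case is the cone over the identified cell. *)
have -> : (pi @^-1: U')%SET = ([set y | (q <= y)%O] :|: [set y | (r <= y)%O])%SET.
  apply/setP => y; rewrite finset.in_setU ![_ \in finset _]finset.in_set.
  rewrite -preE; apply/idP/orP => [|[] h]; first last.
  - exact: uA (piU r (r_tri p q r)) h.
  - exact: uA (piU q (q_tri p q r)) h.
  move=> /below[x1 [y1 [/(zip_eq Z) e1 /(zip_eq Z) e2 xy1]]].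
  have x1t : x1 \in tri by case: e1 => [->//|[]].
  case: e2 => [e|[_ yt]].
    rewrite e in xy1; case/triP: x1t xy1 => -> xy; [|by left|by right].
    by left; apply: le_trans xy; apply/ltW/(zip_lt_q zpqr).
  case/triP: yt => ->; [left; apply/ltW/(zip_lt_q zpqr) => //|by left|by right].
have uset a : upset [set y | a <= y]%SET.
  by move=> y y'; rewrite !finset.inE; apply: le_trans.
have bot a : coconstructible [set y | a <= y]%SET.
  by apply: (@coconstructible_bot _ _ _ a) => [|y]; rewrite finset.inE.
have memI y : (y \in [set y | (q <= y)%O] :&: [set y | (r <= y)%O])%SET = (p <= y).
  rewrite finset.in_setI ![_ \in finset _]finset.in_set.
  apply/andP/idP => [[qy ry]|py]; last first.
    by split; apply: le_trans py; apply/ltW; [apply: (zip_lt_q zpqr) | apply: (zip_lt_r zpqr)].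
  have inc := zip_incomparable zpqr.
  apply: (above_qr zpqr); rewrite lt_def ?qy ?ry andbT; apply: contraNneq inc => e.
    by rewrite e in ry; rewrite /Order.comparable ry orbT.
  by rewrite e in qy; rewrite /Order.comparable qy.
have minp y : minimal_in ([set y | (q <= y)%O] :&: [set y | (r <= y)%O])%SET y -> y = p.
  move=> [yI my]; apply/eqP; rewrite eq_sym; apply: contraPT (my p) => py /(_ _) [].
    by rewrite memI.
  by rewrite lt_def eq_sym py -memI.
have mina a : minimal_in [set y | a <= y]%SET a.
  split=> [|y]; first by rewrite finset.inE.
  by rewrite finset.inE => ay ya; have := lt_le_trans ya ay; rewrite ltxx.
apply: coconstructible_union => //.
- by apply: (@coconstructible_bot _ _ _ p) => [|y]; rewrite memI.
- by move=> y /minp ->; exists q => //; apply: (zip_cov_q zpqr).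
- by move=> y /minp ->; exists r => //; apply: (zip_cov_r zpqr).
Qed.

End Preimage.

(** For upward closed sets in the decompositions below, the triple is inside or
    outside as a whole; this is what lets images commute with intersections. *)
Definition saturated U : Prop :=
  (forall t, t \in tri -> t \in U) \/ (forall t, t \in tri -> t \notin U).

Lemma mem_image_saturated U x : saturated U -> (pi x \in (pi @: U)%SET) = (x \in U).
Proof.
move=> sU; apply/imsetP/idP => [[y yU /(zip_eq Z)[->//|[xt yt]]]|xU]; last by exists x.
by case: sU => sU; [apply: sU | have := sU y yt; rewrite yU].
Qed.

Lemma upset_image U : upset U -> saturated U -> upset (pi @: U)%SET.
Proof.
move=> uU sU y' w' /imsetP[y yU ->]; have [w _ <-] := pi_rep Z w'.
move=> /(zip_le Z)[y1 [w1 [ey <- le1]]]; apply: imset_f; apply: uU le1.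
by rewrite -(mem_image_saturated _ sU) ey imset_f.
Qed.

Lemma saturatedI U V : saturated U -> saturated V -> saturated (U :&: V)%SET.
Proof.
case=> hU; last by move=> _; right=> t /hU; rewrite finset.in_setI => /negbTE->.
case=> hV; last by right=> t /hV; rewrite finset.in_setI andbC => /negbTE->.
by left=> t tt; rewrite finset.in_setI hU ?hV.
Qed.

Lemma imageI U V : saturated U -> saturated V ->
  (pi @: (U :&: V) = (pi @: U) :&: (pi @: V))%SET.
Proof.
move=> sU sV; apply/setP => y'; have [y _ <-] := pi_rep Z y'.
by rewrite finset.in_setI !mem_image_saturated ?finset.in_setI //; apply: saturatedI.
Qed.

Lemma minimal_neq U y : saturated U -> minimal_in U y -> y != p.
Proof.
move=> sU [yU my]; apply: contraPneq yU => yp yU; apply: (my q).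
  case: sU => sU; first by apply/sU/q_tri.
  by have := sU p (p_tri p q r); rewrite -yp yU.
by rewrite yp (zip_lt_q zpqr).
Qed.

Lemma minimal_image U y : saturated U -> minimal_in U y -> minimal_in (pi @: U)%SET (pi y).
Proof.
move=> sU mU; have yp := minimal_neq sU mU; have [yU my] := mU.
split=> [|x' x'U]; first exact: imset_f.
move=> /(lift_below Z yp)[x [_ ex xy]]; apply: (my x) => //.
by rewrite -(mem_image_saturated _ sU) ex.
Qed.

Lemma minimal_image_lift U (x' : P1) : saturated U -> minimal_in (pi @: U)%SET x' ->
  exists2 x, pi x = x' & minimal_in U x.
Proof.
move=> sU [x'U mx']; have [x xp ex] := pi_rep Z x'; exists x => //.
split=> [|w wU wx]; first by rewrite -(mem_image_saturated _ sU) ex.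
by apply: (mx' (pi w)); [apply: imset_f | rewrite -ex; apply: (pi_lt Z)].
Qed.

Lemma covering_image U V : saturated U -> saturated V -> covering U V ->
  covering (pi @: U)%SET (pi @: V)%SET.
Proof.
move=> sU sV cv x' /(minimal_image_lift sU)[x <- mx].
have [y my yx] := cv x mx; exists (pi y); first exact: minimal_image.
apply: (cov_pi Z (z := Some y)) => //; last exact: minimal_neq mx.
by rewrite (inj_eq Some_inj); apply: minimal_neq my.
Qed.

Lemma coconstructible_image_union Q S : upset Q -> upset S -> saturated Q -> saturated S ->
  coconstructible (pi @: Q)%SET -> coconstructible (pi @: S)%SET ->
  coconstructible (pi @: (Q :&: S))%SET ->
  covering (Q :&: S)%SET Q -> covering (Q :&: S)%SET S ->
  coconstructible (pi @: (Q :|: S))%SET.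
Proof.
move=> uQ uS sQ sS cQ cS cI cvQ cvS; rewrite imsetU.
have sI := saturatedI sQ sS.
by apply: coconstructible_union; rewrite -?imageI //;
  [apply: upset_image | apply: upset_image | apply: covering_image | apply: covering_image].
Qed.

Lemma coconstructible_image_bot U x : x \in U -> (forall y, y \in U -> x <= y) ->
  coconstructible (pi @: U)%SET.
Proof.
move=> xU xmin; apply: (@coconstructible_bot _ _ _ (pi x)); first exact: imset_f.
by move=> y' /imsetP[y yU ->]; apply: (pi_le Z); apply: xmin.
Qed.

Lemma coconstructible_image_disjoint U : coconstructible U -> upset U ->
  (forall t, t \in tri -> t \notin U) -> coconstructible (pi @: U)%SET.
Proof.
elim=> {U} [U x xU xmin|Q S uQ uS _ IHQ _ IHS _ IHI cvQ cvS] uU dis.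
  exact: coconstructible_image_bot xU xmin.
have disQ t : t \in tri -> t \notin Q.
  by move=> /dis; rewrite finset.in_setU negb_or => /andP[].
have disS t : t \in tri -> t \notin S.
  by move=> /dis; rewrite finset.in_setU negb_or => /andP[].
have disI t : t \in tri -> t \notin (Q :&: S)%SET.
  by move=> /disQ; rewrite finset.in_setI => /negbTE->.
apply: coconstructible_image_union => //; [by right | by right | exact: IHQ | exact: IHS |].
by apply: IHI => //; apply: upsetI.
Qed.

End ZipCoconstructible.

(** * The quotient poset of a zipping *)

Section QuotientClass.
Variables (d : Order.disp_t) (P : finPOrderType d) (A : {set P}).

Definition class_of (x : P) : quotient A :=
  exist _ (quotient_class A x) (imset_f (quotient_class A) (finset.in_setT x)).

Lemma class_onto (C : quotient A) : exists x, class_of x = C.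
Proof.
case: C => C hC; have /imsetP[x _ e] := hC; exists x.
exact: val_inj.
Qed.

Lemma class_eq x y : class_of x = class_of y <-> x = y \/ x \in A /\ y \in A.
Proof.
rewrite /class_of; split=> [[]|[->//|[xA yA]]]; last first.
  by apply: val_inj; rewrite /= /quotient_class xA yA.
rewrite /quotient_class; case: ifP => xA; case: ifP => yA.
- by right.
- by move/setP/(_ x); rewrite finset.in_set1 xA => /esym/eqP; left.
- by move/setP/(_ y); rewrite finset.in_set1 yA => /eqP; left.
- by move/finset.set1_inj; left.
Qed.

Lemma mem_class x y : y \in val (class_of x) <-> class_of y = class_of x.
Proof.
rewrite class_eq /= /quotient_class; case: ifP => xA; last first.
  rewrite finset.in_set1; by split=> [/eqP|[->|[_ xA']]]; [left | rewrite eqxx | rewrite xA' in xA].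
by split=> [yA|[->|[]]]; [right|..].
Qed.

Lemma class_leP x y : quotient_le (class_of x) (class_of y) <->
  exists x' y', [/\ class_of x' = class_of x, class_of y' = class_of y & x' <= y'].
Proof.
split=> [/existsP[x' /andP[/mem_class ex /existsP[y' /andP[/mem_class ey le]]]]|].
  by exists x', y'.
move=> [x' [y' [/mem_class ex /mem_class ey le]]].
by apply/existsP; exists x'; rewrite ex; apply/existsP; exists y'; rewrite ey.
Qed.

End QuotientClass.

Section ZipType.
Variables (d : Order.disp_t) (P : finPOrderType d) (p q r : P).
Hypothesis zpqr : zippable p q r.
Notation tri := [set p; q; r]%SET.

Fact quotient_le_refl : reflexive (@quotient_le d P tri).
Proof. by move=> C; have [x <-] := class_onto C; apply/class_leP; exists x, x. Qed.

(** The identification creates no cycles in the order. *)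
Lemma tri_between x y z : x \in tri -> z \in tri -> x <= y -> y <= z -> y \in tri.
Proof.
move=> xt zt xy yz; apply: contrapT => /negP yt.
have yp : y < p.
  rewrite lt_def (le_trans yz) ?(tri_le_p zpqr) // andbT.
  by apply: contraNneq yt => <-; apply: p_tri.
have [yq yr] : y < q /\ y < r.
  by apply: (below_p zpqr yp); apply: contraNneq yt => ->; [apply: q_tri|apply: r_tri].
have [qnp rnp _] := zip_neq zpqr.
have := tri_lt zpqr xt (q_tri p q r) (le_lt_trans xy yq).
by move/eqP; rewrite (negbTE qnp).
Qed.

Fact quotient_le_anti : antisymmetric (@quotient_le d P tri).
Proof.
move=> C D; have [x <-] := class_onto C; have [y <-] := class_onto D.
move=> /andP[/class_leP[x1 [y1 [/class_eq ex1 /class_eq ey1 le1]]]].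
move=> /class_leP[y2 [x2 [/class_eq ey2 /class_eq ex2 le2]]]; apply/class_eq.
have [xt|xt] := boolP (x \in tri).
  right; split=> //; have x1t : x1 \in tri by case: ex1 => [->|[]].
  have x2t : x2 \in tri by case: ex2 => [->|[]].
  case: ey1 => [e1|[]//]; case: ey2 => [e2|[]//]; rewrite e1 in le1; rewrite e2 in le2.
  exact: tri_between x1t x2t le1 le2.
case: ex1 => [e1|[_ xt']]; last by rewrite xt' in xt.
case: ex2 => [e2|[_ xt']]; last by rewrite xt' in xt.
rewrite {}e1 in le1; rewrite {}e2 in le2.
have [yt|yt] := boolP (y \in tri).
  have y1t : y1 \in tri by case: ey1 => [->|[]].
  have y2t : y2 \in tri by case: ey2 => [->|[]].
  by have := tri_between y2t y1t le2 le1; rewrite (negbTE xt).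
case: ey1 => [e1|[_ yt']]; last by rewrite yt' in yt.
case: ey2 => [e2|[_ yt']]; last by rewrite yt' in yt.
by left; apply/eqP; rewrite eq_le -{1}e1 -e2 le1.
Qed.

(** The middle class can only have two representatives when it is the triple, and an
    element outside the triple that is below one of its members is below all of
    them. *)
Fact quotient_le_trans : transitive (@quotient_le d P tri).
Proof.
move=> D C F; have [x <-] := class_onto C; have [y <-] := class_onto D.
have [z <-] := class_onto F.
move=> /class_leP[x1 [y1 [ex1 /class_eq ey1 le1]]].
move=> /class_leP[y2 [z2 [/class_eq ey2 ez2 le2]]]; apply/class_leP.
have [e12|y1y2] := eqVneq y1 y2.
  by exists x1, z2; split=> //; apply: le_trans le1 _; rewrite e12.
have [y1t y2t] : y1 \in tri /\ y2 \in tri.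
  case: ey1 y1y2 => [->|[y1t yt]] y1y2; case: ey2 y1y2 => [->|[y2t yt']] //.
  by rewrite eqxx.
have triE a b : a \in tri -> b \in tri -> class_of tri a = class_of tri b.
  by move=> aT bT; apply/class_eq; right.
have [x1t|x1t] := boolP (x1 \in tri).
  by exists y2, z2; split=> //; rewrite -ex1; apply: triE.
exists x1, z2; split=> //; apply: le_trans le2.
have xp : x1 < p.
  rewrite lt_def (le_trans le1) ?(tri_le_p zpqr) // andbT.
  by apply: contraNneq x1t => <-; apply: p_tri.
have [xq xr] : x1 < q /\ x1 < r.
  by apply: (below_p zpqr xp); apply: contraNneq x1t => ->; [apply: q_tri|apply: r_tri].
by case/triP: y2t => ->; apply: ltW.
Qed.

(** The quotient set under a new name that depends on zippability, without which the
    relation on it need not be an order. *)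
Definition zip_type (_ : zippable p q r) : Type :=
  {C : {set P} | C \in [set quotient_class tri x | x in [set: P]%SET]%SET}.

HB.instance Definition _ := Finite.on (zip_type zpqr).
HB.instance Definition _ := Order.Le_isPOrder.Build d (zip_type zpqr)
  quotient_le_refl quotient_le_anti quotient_le_trans.

Lemma zip_type_zip : elementarily_zips P (zip_type zpqr).
Proof.
by exists p, q, r; split=> //; exists id => //; exists id.
Qed.

Lemma zip_type_map : zip_map p q r (class_of tri : P -> zip_type zpqr).
Proof.
split=> //; [exact: class_onto | exact: class_eq | exact: class_leP].
Qed.

End ZipType.

Lemma elementarily_zips_map (d d1 : Order.disp_t) (P : finPOrderType d)
    (P1 : finPOrderType d1) : elementarily_zips P P1 ->
  exists p q r (pi : P -> P1), zip_map p q r pi.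
Proof.
move=> [p [q [r [zpqr [f [g fK gK] fle]]]]].
exists p, q, r, (g \o class_of [set p; q; r]%SET); split=> //=.
- by move=> y; have [x e] := class_onto (f y); exists x; rewrite e fK.
- by move=> x y; split=> [/(can_inj gK)/class_eq|/class_eq ->].
- move=> x y; rewrite fle !gK class_leP.
  by split=> -[x' [y' [ex ey le]]]; exists x', y'; split=> //;
   [rewrite ex | rewrite ey | apply: (can_inj gK) | apply: (can_inj gK)].
Qed.

(** * Finding a zipping in a constructible dual *)

Section FindZip.
Variables (d : Order.disp_t) (P : finPOrderType d).
Hypothesis cP : cellular P.
Implicit Types (x y m a b : P) (A Q S : {set P}).

(** All minimal elements cover the same cells. The sets reached by following a
    decomposition have this property, and it forces the cells below [p] to form an
    octahedral sphere. *)
Definition equifaceted A : Prop :=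
  forall m m', minimal_in A m -> minimal_in A m' -> forall z, cov z m = cov z m'.

Definition has_bottom A : Prop := exists2 a, a \in A & forall x, x \in A -> a <= x.

(** The induction hypothesis of [coconstructible_zips]; the condition on the cells
    below [p] keeps [p] out of the other parts of the decompositions higher up. *)
Definition zips_within A : Prop := exists p q r, [/\ zippable p q r,
  q \in A, r \in A,
  forall x, x < p -> x \in A \/ forall m, minimal_in A m -> x < m &
  forall (d1 : Order.disp_t) (P1 : finPOrderType d1) (pi : P -> P1),
    zip_map p q r pi -> coconstructible (pi @: A)%SET].

Lemma below_facets x m m' : (forall z, cov z m = cov z m') -> x < m -> x < m'.
Proof.
move=> eqm /facet_exists[w wm xw]; apply: le_lt_trans xw _.
by move: wm; rewrite eqm => /covP[].
Qed.

(** If [S] contained [p], it would have a minimal element [y] below [p]. By the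
    condition on the cells below [p] this [y] is in [Q], as it is minimal in the
    union; but a minimal element of the intersection covers an element of [S]. So
    [S] avoids the triple and is not changed by the zipping. *)
Lemma zips_within_side Q S : upset Q -> upset S ->
  coconstructible S -> coconstructible (Q :&: S)%SET ->
  covering (Q :&: S)%SET Q -> covering (Q :&: S)%SET S ->
  equifaceted (Q :|: S)%SET -> zips_within Q -> zips_within (Q :|: S)%SET.
Proof.
move=> uQ uS cS cI cvQ cvS eqA [p [q [r [zpqr qQ rQ below cz]]]].
have pQ : p \in Q by apply: uQ qQ (ltW (zip_lt_q zpqr)).
have [m0 mQ0 _] := minimal_exists pQ.
have mA0 : minimal_in (Q :|: S)%SET m0 by apply: minimal_unionl.
have pS : p \notin S.
  apply/negP => /minimal_exists[y mS yp].
  have [yS ny] := mS.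
  have yQ : y \in Q.
    move: yp; rewrite le_eqVlt => /orP[/eqP->//|/below[//|/(_ m0 mQ0) ym]].
    by case: mA0 => _ /(_ y); rewrite finset.in_setU yS orbT => /(_ isT).
  have [|z [zS _] /covP[zy _]] := cvS y; last exact: (ny z).
  by split=> [|w]; rewrite finset.in_setI ?yQ // => /andP[_ /ny].
have dis t : t \in [set p; q; r]%SET -> t \notin S.
  move=> tt; apply: contra pS => tS; apply: uS tS _; exact: tri_le_p zpqr _ tt.
exists p, q, r; split=> //; rewrite ?finset.in_setU ?qQ ?rQ //.
  move=> x /below[xQ|xm]; first by left; rewrite finset.in_setU xQ.
  by right=> m mA; apply: below_facets (eqA _ _ mA0 mA) (xm _ mQ0).
move=> d1 P1 pi Z; apply: (coconstructible_image_union Z) => //.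
- by left=> t /triP[] ->.
- by right.
- exact: cz.
- exact: (coconstructible_image_disjoint Z).
- apply: (coconstructible_image_disjoint Z) => //; first exact: upsetI.
  by move=> t /dis; rewrite finset.in_setI andbC => /negbTE->.
Qed.

(** As [a] and [b] cover the same cells, [a + b] is a cycle, so it is the whole
    boundary of [m]. *)
Lemma facets_pair m a b : a != b -> cov (Some a) m -> cov (Some b) m ->
  (forall z, cov z a = cov z b) -> forall z, cov z m = (z == Some a) || (z == Some b).
Proof.
move=> ab am bm eqab.
have [y|z|h|h] := cellular_cycle cP (s := m) (c := [pred y | (y == a) || (y == b)]).
- by case/orP => /eqP->.
- rewrite /boundary (bigD1 a) /= ?eqxx // (bigD1 b) /= ?eqxx ?orbT 1?eq_sym //.
  rewrite big1 => [|y]; first by rewrite eqab addbF addbb.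
  by move=> /andP[/andP[/orP[]/eqP-> //]]; rewrite eqxx.
- by have := h a; rewrite /= eqxx.
- move=> [y|]; last by apply/negP => /covP[_ /(_ a isT)]; case/covP: am.
  rewrite !(inj_eq Some_inj); apply/idP/orP => [/h/orP//|].
  by case=> /eqP->.
Qed.

(** A part that is no cone contains a zippable triple by induction. If both parts
    are cones, over [a] and [b], then the minimal elements of their intersection
    have [a] and [b] as their facets: either there is one such element, which is
    zipped with [a] and [b], or the induction hypothesis applies to the
    intersection. *)
Lemma coconstructible_zips A : coconstructible A -> upset A -> equifaceted A ->
  has_bottom A \/ zips_within A.
Proof.
elim=> {A} [A a aA amin|Q S uQ uS cQ IHQ cS IHS cI IHI cvQ cvS] uA eqA.
  by left; exists a.
have minQ m : minimal_in Q m -> minimal_in (Q :|: S)%SET m by apply: minimal_unionl.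
have minS m : minimal_in S m -> minimal_in (Q :|: S)%SET m by apply: minimal_unionr.
have eqfQ : equifaceted Q by move=> m m' /minQ mA /minQ m'A; apply: eqA.
have eqfS : equifaceted S by move=> m m' /minS mA /minS m'A; apply: eqA.
have [[a aQ amin]|zQ] := IHQ uQ eqfQ; last by right; apply: zips_within_side.
have [[b bS bmin]|zS] := IHS uS eqfS; last first.
  right; rewrite finset.setUC in eqA *; rewrite finset.setIC in cI cvQ cvS.
  exact: zips_within_side.
have ma : minimal_in Q a.
  by split=> // x /amin ax xa; have := le_lt_trans ax xa; rewrite ltxx.
have mb : minimal_in S b.
  by split=> // x /bmin bx xb; have := le_lt_trans bx xb; rewrite ltxx.
have eqQ m : minimal_in Q m -> m = a.
  move=> [mQ nm]; apply/eqP/negPn/negP => mna; apply: (nm a aQ).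
  by rewrite lt_def mna amin.
have eqS m : minimal_in S m -> m = b.
  move=> [mS nm]; apply/eqP/negPn/negP => mnb; apply: (nm b bS).
  by rewrite lt_def mnb bmin.
have mAab m : minimal_in (Q :|: S)%SET m -> m = a \/ m = b.
  move=> [mA nm]; move: (mA); rewrite finset.in_setU => /orP[mQ|mS]; [left|right].
    by apply: eqQ; split=> // x xQ; apply: nm; rewrite finset.in_setU xQ.
  by apply: eqS; split=> // x xS; apply: nm; rewrite finset.in_setU xS orbT.
have eqab z : cov z a = cov z b by apply: eqA; [apply: minQ | apply: minS].
have [ab|ab] := eqVneq a b.
  left; exists a; first by rewrite finset.in_setU aQ.
  by move=> x; rewrite finset.in_setU => /orP[/amin//|/bmin]; rewrite ab.
have covm m : minimal_in (Q :&: S)%SET m -> cov (Some a) m /\ cov (Some b) m.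
  move=> mI; have [y /eqQ-> ?] := cvQ m mI; have [z /eqS-> ?] := cvS m mI.
  by [].
have facets m : minimal_in (Q :&: S)%SET m ->
    forall z, cov z m = (z == Some a) || (z == Some b).
  by move=> /covm[am bm]; apply: facets_pair.
have belowm m x : minimal_in (Q :&: S)%SET m -> x < m ->
    x \in (Q :|: S)%SET \/ forall m', minimal_in (Q :|: S)%SET m' -> x < m'.
  move=> mI /facet_exists[w wm xw].
  have {wm} : w = a \/ w = b.
    move: wm; rewrite (facets m mI) !(inj_eq Some_inj).
    by move=> /orP[]/eqP->; [left|right].
  move: xw; rewrite le_eqVlt => /orP[/eqP-> [->|->]|xw wab].
  - by left; rewrite finset.in_setU aQ.
  - by left; rewrite finset.in_setU bS orbT.
  right=> m' /mAab; have [xa xb] : x < a /\ x < b.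
    case: wab xw => -> h; split=> //; apply: below_facets h => z //.
  by case=> ->.
right; have [||[p pI pmin]|[p [q [r [zpqr qI rI below cz]]]]] := IHI.
- exact: upsetI.
- by move=> m m' /facets em /facets em' z; rewrite em em'.
- have mp : minimal_in (Q :&: S)%SET p.
    by split=> // x /pmin px xp; have := le_lt_trans px xp; rewrite ltxx.
  have [ap bp] := covm p mp.
  have covers_p y : cov (Some y) p -> covers p y.
    move=> /covP[/= yp h]; split; rewrite ?finset.in_setT // => x _ [yx xp].
    exact: (h x).
  have [_ na] := minQ a ma; have [_ nb] := minS b mb.
  exists p, a, b; split.
  + split; [exact: covers_p | exact: covers_p | | |].
    * rewrite /Order.comparable !le_eqVlt eq_sym [b == a]eq_sym (negbTE ab) /=.
      apply/negP => /orP[]; first by apply: nb; rewrite finset.in_setU aQ.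
      by apply: na; rewrite finset.in_setU bS orbT.
    * move=> s sp sa sb; have [w wp sw] := facet_exists sp.
      move: wp; rewrite (facets p mp) !(inj_eq Some_inj) => /orP[]/eqP ew.
        have {}sw : s < a by rewrite lt_def eq_sym sa -ew.
        by split=> //; apply: below_facets sw.
      have {}sw : s < b by rewrite lt_def eq_sym sb -ew.
      by split=> //; apply: below_facets sw => z; rewrite eqab.
    * move=> s as' bs; apply: pmin; rewrite finset.in_setI.
      by rewrite (uQ a s aQ (ltW as')) (uS b s bS (ltW bs)).
  + by rewrite finset.in_setU aQ.
  + by rewrite finset.in_setU bS orbT.
  + by move=> x; apply: belowm.
  + move=> d1 P1 pi Z.
    apply: (@coconstructible_bot _ _ _ (pi a)).
      by apply: imset_f; rewrite finset.in_setU aQ.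
    move=> y' /imsetP[y + ->]; rewrite finset.in_setU => /orP[/amin|/bmin] h.
      exact: (pi_le Z).
    by rewrite (tri_pi Z (q_tri p a b) (r_tri p a b)) (pi_le Z).
have subI x : x \in (Q :&: S)%SET -> x \in Q /\ x \in S.
  by rewrite finset.in_setI => /andP[].
have [qQ qS] := subI q qI; have [rQ rS] := subI r rI.
have pQ : p \in Q by apply: uQ qQ (ltW (zip_lt_q zpqr)).
have pS : p \in S by apply: uS qS (ltW (zip_lt_q zpqr)).
have [m0 mI0 _] := minimal_exists qI.
exists p, q, r; split=> //; rewrite ?finset.in_setU ?qQ ?rQ //.
  move=> x /below[/subI[xQ _]|/(_ m0 mI0)]; last exact: belowm.
  by left; rewrite finset.in_setU xQ.
move=> d1 P1 pi Z; apply: (coconstructible_image_union Z) => //.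
- by left=> t /triP[] ->.
- by left=> t /triP[] ->.
- exact: (coconstructible_image_bot Z aQ).
- exact: (coconstructible_image_bot Z bS).
- exact: cz.
Qed.

(** A cell that covers the least element would have a single vertex, against the
    vanishing of the augmentation of its boundary. *)
Lemma bottom_singleton : has_bottom [set: P]%SET -> #|P| = 1%N.
Proof.
move=> [a _ amin].
suff h x : x = a.
  by rewrite -(cardsT P) (_ : [set: P]%SET = [set a]%SET) ?cards1 //;
     apply/setP => x; rewrite !finset.inE (h x) eqxx.
apply/eqP/negPn/negP => xa.
have ax : a < x by rewrite lt_def xa amin ?finset.in_setT.
have [y ay _] := @cov_exists _ _ (Some a) x ax.
have min v : ~ v < a.
  by move=> va; have := lt_le_trans va (amin v (finset.in_setT _)); rewrite ltxx.
have a0 : cov None a by apply/covP; split=> // v _ /min.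
have := cellular_boundary2 cP y None; rewrite /boundary (bigD1 a) //= a0 big1 // => v.
move=> /andP[/covP[/= vy _] va]; case/covP: ay => _ /(_ v) /=; case=> //.
by rewrite lt_def va amin ?finset.in_setT.
Qed.

End FindZip.

Lemma zips_onto_coconstructible (d d' : Order.disp_t) (P : finPOrderType d)
    (Q : finPOrderType d') : zips_onto P Q -> #|Q| = 1%N -> cellular P ->
  coconstructible [set: P]%SET.
Proof.
elim=> {d d' P Q} [d d' P Q [f bijf _] cQ cP|d d1 d' P P1 Q ez _ IH cQ cP].
  have /eqP/fintype1P[a aE] : #|P| = 1%N by rewrite (bij_eq_card bijf) cQ.
  by apply: (@coconstructible_bot _ _ _ a) => [|x _]; rewrite ?finset.in_setT ?aE.
have [p [q [r [pi Z]]]] := elementarily_zips_map ez.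
have cP1 := zip_cellular Z cP.
rewrite -(finset.preimsetT pi); apply: (coconstructible_preimage Z cP); first exact: IH.
by move=> x y _ _; rewrite finset.in_setT.
Qed.

Lemma coconstructible_zips_onto (d : Order.disp_t) (P : finPOrderType d) :
  cellular P -> coconstructible [set: P]%SET -> zips_onto P 'I_1.
Proof.
have [n] := ubnP #|P|; elim: n d P => // n IH d P; rewrite ltnS => lt_n cP ccP.
have [||bot|[p [q [r [zpqr _ _ _ cz]]]]] := coconstructible_zips cP ccP.
- by move=> x y _ _; rewrite finset.in_setT.
- have E m : minimal_in [set: P]%SET m -> forall z, cov z m = (z == None).
    move=> [_ nm] [z|]; first by apply/negP => /covP[zm _]; apply: (nm z (finset.in_setT z) zm).
    by apply/covP; split=> // x _; apply: nm; rewrite finset.in_setT.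
  by move=> m m' /E em /E em' z; rewrite em em'.
- have /eqP/fintype1P[a aE] := bottom_singleton cP bot.
  apply: zips_onto_iso; exists (fun=> ord0).
    by exists (fun=> a) => x; [rewrite aE | rewrite [x]ord1].
  by move=> x y; rewrite (aE x) (aE y) !lexx.
have Z := zip_type_map zpqr.
apply: (zips_onto_step (zip_type_zip zpqr)); apply: IH.
- apply: leq_trans lt_n.
  have rep (C : zip_type zpqr) : exists x, x != p /\ class_of [set p; q; r]%SET x = C.
    by have [x xp ex] := pi_rep Z C; exists x.
  have [s sE] := boolp.choice rep.
  have sI : injective s by apply: can_inj (fun C => (sE C).2).
  rewrite -(card_codom sI); apply: proper_card; apply/fintype.properP; split.
    exact: fintype.subset_predT.
  by exists p => //; apply/negP => /codomP[C e]; have [] := sE C; rewrite -e eqxx.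
- exact: zip_cellular Z cP.
- suff <- : (class_of [set p; q; r]%SET @: [set: P])%SET = [set: zip_type zpqr]%SET.
    exact: cz Z.
  apply/setP => C; rewrite finset.in_setT; have [x <-] := class_onto C.
  exact/imset_f/finset.in_setT.
Qed.

Local Close Scope order_scope.

Theorem theorem1p5 (R : realType) (d : Order.disp_t) (K : finPOrderType d)
    (hK : cell_complex K R) :
  zips_onto K 'I_1 <-> constructible ([set: K^d] : {set K^d}).
Proof.
have cK := cell_complex_cellular hK.
have upT : upset [set: K]%SET by move=> x y _ _; rewrite finset.in_setT.
split=> [zK|ccK].
  apply: (coconstructible_constructible _ upT).
  by apply: zips_onto_coconstructible zK _ cK; rewrite card_ord.
by apply: coconstructible_zips_onto cK _; apply: constructible_coconstructible ccK upT.
Qed.
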